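(* (a) If $k\ge 2$ and $d\ge 2k-3$ are integers, there is a constant $K_{d,k}$ such that for all $n\ge 1$, $$\left|f(n,d,k)-\left(1+\frac{k-1}{d-k+2}\right)n\right|\le K_{d,k}.$$ (b) If $k\ge 3$ and $d$ are integers with $k-2\le d\le 2k-3$, there is a constant $K_{d,k}$ such that for all $n\ge 1$, $$\left|f(n,d,k)-\left(2+\frac{2k-3-d}{2d+3-k}\right)n\right|\le K_{d,k}.$$
   Context: For integers $d\ge 1$, $n\ge 1$, $T_d(n)=\{(x_1,\dots,x_d)\in\mathbb{Z}_{\ge 0}^d : x_1+\dots+x_d\le n-1\}$. A $k$-cover of $T_d(n)$ is a finite multiset of affine hyperplanes in $\mathbb{R}^d$ such that every point of $T_d(n)$ lies in at least $k$ of them (with multiplicity). $f(n,d,k)$ is the minimum cardinality of a $k$-cover of $T_d(n)$. *)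

(* Defs.v *)
From HB Require Import structures.
From mathcomp Require Import all_boot all_order all_algebra.
From mathcomp Require Import boolp reals.
Set Implicit Arguments. Unset Strict Implicit. Unset Printing Implicit Defensive.
Import Order.TTheory GRing.Theory Num.Theory.
Local Open Scope ring_scope.

(* An affine hyperplane {x in R^d | a . x = b} is represented by the pair
   (a, b) with a a nonzero row vector. *)
Definition hyperplane (R : realType) (d : nat) := ('rV[R]_d * R)%type.

Definition is_hyperplane (R : realType) (d : nat) (h : hyperplane R d) : bool :=
  h.1 != 0.

Definition on_hyp (R : realType) (d : nat) (h : hyperplane R d)
  (x : 'I_d -> nat) : bool :=
  \sum_(i < d) h.1 ord0 i * (x i)%:R == h.2.

Definition inT (d n : nat) (x : 'I_d -> nat) : Prop :=
  (\sum_(i < d) x i < n)%N.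

(* A finite multiset of hyperplanes is a list; multiplicity = number of
   occurrences. It is a k-cover of T_d(n) if every point of T_d(n) lies in
   at least k of its members (counted with multiplicity). *)
Definition is_kcover (R : realType) (n d k : nat) (H : seq (hyperplane R d)) : Prop :=
  all (@is_hyperplane R d) H /\
  forall x : 'I_d -> nat, @inT d n x -> (k <= count (fun h => on_hyp h x) H)%N.

Definition has_kcover_of_size (R : realType) (n d k m : nat) : Prop :=
  exists H : seq (hyperplane R d), size H = m /\ @is_kcover R n d k H.

(* f(n,d,k): the minimum cardinality of a k-cover of T_d(n)
   (default 0 if no cover exists, which never happens for d >= 1). *)
Definition f (R : realType) (n d k : nat) : nat :=
  match pselect (exists m, has_kcover_of_size R n d k m) with
  | left Hex =>
      @ex_minn (fun m => `[< has_kcover_of_size R n d k m >])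
        (let: ex_intro m Hm := Hex in ex_intro _ m (asboolT Hm))
  | right _ => 0%N
  end.

(* Main.v *)
(* A point of T_d(n) is a nonnegative integer vector with d + 1 barycentric
   coordinates of sum n - 1; a hyperplane becomes a linear form up to constants,
   and the faces become slices indexed by subsets W of the d + 1 vertices.

   Upper bound: take the hyperplanes on which one barycentric coordinate is a
   constant c < j t, for j = 1 (and j = 2 in part (b)) and t just above n / q.
   A point with coordinates y_v lies on at least sum_v (s - floor (y_v / t)) of
   them, where s = 1 (or 2), and sum_v floor (y_v / t) < q.

   Lower bound: at the two ends, (w, k) = (2k - 2, k) and (k - 1, k), w = |W|, one
   proves a statement about arbitrary families, not only covers: some lattice line
   meets the family with a total defect that makes up for the missing planes.  This
   goes by induction on w in steps of two.  For a pair {i, j}, a layer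
   x_i + x_j = z is a product of a segment and a smaller simplex; a plane parallel
   to both factors lies on one layer at most, so a layer free of such planes
   exists.  If z is small, the induction hypothesis applies to a column of the
   layer; if z is large, it gives a line L of the second factor, and one counts
   incidences on the boundary of a rectangle inside the segment times L.
   The other cases follow by induction on w: a vertex i for which few planes are
   of the form x_i = c has first layers x_i = a with none of them and x_i = b with
   at most one, and these layers are covered k and k - 1 times by the remaining
   planes. *)
Require Import Defs.
From HB Require Import structures.
From mathcomp Require Import all_boot all_order all_algebra.
From mathcomp Require Import boolp reals.
From mathcomp Require Import zify ring lra.
Import Order.TTheory GRing.Theory Num.Theory.
Local Open Scope ring_scope.
Set Implicit Arguments. Unset Strict Implicit. Unset Printing Implicit Defensive.

(** * Pigeonhole principles for finite sums *)

Lemma sum_bool_le1 (I : finType) (P : pred I) :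
  (forall x y, P x -> P y -> x = y) -> (\sum_x (P x : nat) <= 1)%N.
Proof.
move=> inj; have [x Px|P0] := pickP P; last by rewrite big1 // => x _; rewrite P0.
rewrite (bigD1 x) //= Px big1 // => y /negP yx.
by case Py: (P y) => //; case: yx; rewrite (inj _ _ Py Px).
Qed.

Lemma exists_le_of_sum (I : finType) (f g : I -> nat) :
  (\sum_x f x < \sum_x g x)%N -> exists x, (f x < g x)%N.
Proof.
move=> lt_fg; have [x Px|P0] := pickP (fun x => (f x < g x)%N); first by exists x.
by move: lt_fg; rewrite ltnNge leq_sum // => x _; rewrite leqNgt P0.
Qed.

(** The search is capped: if no index below [N] works, then [a = N] and the middle clause is
    void. *)
Lemma least_below (m : nat -> nat) (r N : nat) :
  exists a, [/\ (a <= N)%N, (a < N)%N -> (m a <= r)%N &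
    forall c, (c < a)%N -> (r < m c)%N].
Proof.
have ex : exists c, (c == N) || (m c <= r)%N by exists N; rewrite eqxx.
case: (ex_minnP ex) => a Pa amin; exists a; split.
- by apply: amin; rewrite eqxx.
- by move=> aN; case/orP: Pa => // /eqP aE; move: aN; rewrite aE ltnn.
- move=> c ca; rewrite ltnNge; apply/negP => mc.
  by have := amin c; rewrite mc orbT leqNgt ca => /(_ isT).
Qed.

(** * Planes and lattice segments *)

Section Slices.
Variables (R : realFieldType) (T : finType).

(* The hyperplane [\sum_v h.1 v * x v = h.2], in barycentric coordinates. *)
Definition plane := ((T -> R) * R)%type.

Definition val_at (h : plane) (x : T -> nat) : R :=
  \sum_v h.1 v * (x v)%:R - h.2.

Definition on (h : plane) (x : T -> nat) : bool := val_at h x == 0.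

(** On a slice the coordinates in [W] have a fixed sum, so a form with equal coefficients on [W] is
    constant there. The condition thus says that the plane cuts the slice properly. *)
Definition nonconst (W : {set T}) (h : plane) : bool :=
  [exists u in W, [exists v in W, h.1 u != h.1 v]].

Definition mult (H : seq plane) (x : T -> nat) : nat :=
  (\sum_(h <- H) on h x)%N.

Definition num (H : seq plane) (P : pred plane) : nat :=
  (\sum_(h <- H) P h)%N.

Definition in_slice (W : {set T}) (c : T -> nat) (M : nat) (x : T -> nat) :=
  (forall v, v \notin W -> x v = c v) /\ (\sum_(v in W) x v)%N = M.

Definition seg (u v : T) (c : T -> nat) (M t : nat) : T -> nat :=
  fun w => if w == u then t else if w == v then (M - t)%N else c w.

(** The subtraction is truncated: an excess at one point does not make up for a shortage at
    another. *)
Definition defect (k : nat) (H : seq plane) (u v : T) (c : T -> nat) (M : nat) :=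
  (\sum_(t < M.+1) (k - mult H (seg u v c M t)))%N.

Definition seg_in (W : {set T}) (c : T -> nat) (M : nat) (u v : T)
    (c' : T -> nat) (M' : nat) :=
  [/\ u \in W, v \in W, u != v &
     forall t, (t <= M')%N -> in_slice W c M (seg u v c' M' t)].

Definition upd (c : T -> nat) (a : T) (n : nat) : T -> nat :=
  fun w => if w == a then n else c w.

Lemma val_ext h x y : x =1 y -> val_at h x = val_at h y.
Proof. by move=> xy; rewrite /val_at; under eq_bigr do rewrite xy. Qed.

Lemma on_ext h x y : x =1 y -> on h x = on h y.
Proof. by move=> xy; rewrite /on (val_ext _ xy). Qed.

Lemma mult_ext H x y : x =1 y -> mult H x = mult H y.
Proof. by move=> xy; apply: eq_bigr => h _; rewrite (on_ext _ xy). Qed.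

Lemma constP (W : {set T}) (h : plane) :
  reflect {in W &, forall u v, h.1 u = h.1 v} (~~ nonconst W h).
Proof.
apply: (iffP idP) => [nc u v uW vW|cst].
  apply: contraNeq nc => ne.
  by apply/existsP; exists u; rewrite uW; apply/existsP; exists v; rewrite vW.
apply/negP => /existsP[u /andP[uW /existsP[v /andP[vW]]]].
by rewrite (cst u v) ?eqxx.
Qed.

Lemma val_seg h u v c M t : u != v -> (t <= M)%N ->
  val_at h (seg u v c M t) = val_at h (seg u v c M 0) + (h.1 u - h.1 v) * t%:R.
Proof.
move=> uv tM.
have E r : \sum_w h.1 w * (seg u v c M r w)%:R = h.1 u * r%:R +
    (h.1 v * (M - r)%:R + \sum_(w | (w != u) && (w != v)) h.1 w * (c w)%:R).
  rewrite (bigD1 u) //= (bigD1 v) 1?eq_sym //= /seg !eqxx.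
  rewrite [v == u]eq_sym (negPf uv); congr (_ + (_ + _)).
  by apply: eq_bigr => w /andP[/negPf-> /negPf->].
by rewrite /val_at !E subn0 natrB //; ring.
Qed.

Lemma seg_inj h u v c M t t' : u != v -> h.1 u != h.1 v ->
  (t <= M)%N -> (t' <= M)%N ->
  on h (seg u v c M t) -> on h (seg u v c M t') -> t = t'.
Proof.
move=> uv ne tM tM' /eqP e1 /eqP e2.
have /eqP : (h.1 u - h.1 v) * (t%:R - t'%:R) = 0.
  move: e1 e2; rewrite (val_seg _ _ uv tM) (val_seg _ _ uv tM') => e1 e2.
  transitivity (0 - 0 : R); last by rewrite subr0.
  by rewrite -{1}e1 -e2; ring.
by rewrite mulf_eq0 !subr_eq0 (negPf ne) /= eqr_nat => /eqP.
Qed.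

Lemma on_const (W : {set T}) (c : T -> nat) M h x y : ~~ nonconst W h ->
  in_slice W c M x -> in_slice W c M y -> on h x = on h y.
Proof.
move=> /constP cst [xc xM] [yc yM]; congr (_ - _ == _).
rewrite (bigID (mem W)) [RHS](bigID (mem W)) /=; congr (_ + _); last first.
  by apply: eq_bigr => v vW; rewrite xc // yc.
have [w wW|W0] := pickP (mem W); last by rewrite !big_pred0.
transitivity (h.1 w * M%:R).
  rewrite -xM natr_sum mulr_sumr; apply: eq_bigr => v vW.
  by rewrite (cst v w).
rewrite -yM natr_sum mulr_sumr; apply: eq_bigr => v vW.
by rewrite (cst v w).
Qed.

Lemma sum_planes (H : seq plane) (f g : plane -> nat) :
  {in H, forall h, (f h <= g h)%N} ->
  (\sum_(h <- H) f h <= \sum_(h <- H) g h)%N.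
Proof.
move=> fg; rewrite big_seq [leqRHS]big_seq; exact: leq_sum.
Qed.

(* A cover has no defect, so that its size is then at least [s.+1 * n - K]; the
   induction needs the case of an arbitrary family. *)
Definition defect_bound (s w k K : nat) : Prop :=
  forall (W : {set T}) (H : seq plane) (c : T -> nat) (M : nat),
  #|W| = w -> {in H, forall h, nonconst W h} ->
  exists u v c' M', seg_in W c M u v c' M' /\
    (s.+1 * M.+1 <= size H + 2 * defect k H u v c' M' + K)%N.

Lemma no_defect_bound (s k K : nat) (W : {set T}) H c M :
  ~ (exists u v c' M', seg_in W c M u v c' M' /\
       (s.+1 * M.+1 <= size H + 2 * defect k H u v c' M' + K)%N) ->
  forall u v c' M', seg_in W c M u v c' M' ->
    (size H + 2 * defect k H u v c' M' + K < s.+1 * M.+1)%N.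
Proof.
move=> no u v c' M' sg; rewrite ltnNge; apply/negP => le.
by apply: no; exists u, v, c', M'.
Qed.

(** Double counting: a plane transverse to the segment meets it at most once. *)
Lemma mult_seg_le H (u v : T) (c : T -> nat) M (P : pred plane) :
  u != v -> {in H, forall h, P h -> h.1 u != h.1 v} ->
  (\sum_(t < M.+1) \sum_(h <- H) (P h && on h (seg u v c M t)) <= num H P)%N.
Proof.
move=> uv ne; rewrite exchange_big /=; apply: sum_planes => h hH.
case Ph: (P h) => /=; last by rewrite big1.
apply: sum_bool_le1 => t t' ot ot'; apply: val_inj => /=.
by apply: (seg_inj uv (ne h hH Ph) _ _ ot ot'); rewrite -ltnS.
Qed.

Lemma size_num H : size H = num H xpredT.
Proof. by rewrite /num sum1_size. Qed.

Lemma in_slice_seg (W : {set T}) c M u v (c' : T -> nat) M' t :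
  u \in W -> v \in W -> u != v -> (t <= M')%N ->
  (forall w, w \notin W -> c' w = c w) ->
  (M' + \sum_(w in W :\ u :\ v) c' w)%N = M ->
  in_slice W c M (seg u v c' M' t).
Proof.
move=> uW vW uv tM cc <-; split.
  move=> w wW; rewrite /seg ifN; last by apply: contraNneq wW => ->.
  by rewrite ifN ?cc //; apply: contraNneq wW => ->.
rewrite (big_setD1 u) //= (big_setD1 v) /=; last by rewrite !inE eq_sym uv.
rewrite addnA /seg !eqxx [v == u]eq_sym (negPf uv) subnKC //; congr (_ + _)%N.
by apply: eq_bigr => w; rewrite !inE => /and3P[/negPf-> /negPf-> _].
Qed.

(** The whole slice is one segment and every plane is transverse to it, so [H] supplies at most
    [size H] of the incidences demanded. *)
Lemma defect_bound_pair s : defect_bound s 2 s.+1 0.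
Proof.
move=> W H c M cardW nc.
have [u [v [uv WE]]] := cards2P _ (introT eqP cardW); subst W.
have uW : u \in [set u; v] by rewrite !inE eqxx.
have vW : v \in [set u; v] by rewrite !inE eqxx orbT.
have ne h : h \in H -> h.1 u != h.1 v.
  move=> /nc; apply: contraTneq => e; apply/constP => x y.
  by rewrite !inE => /orP[] /eqP-> /orP[] /eqP->.
exists u, v, c, M; split.
  split=> // t tM; apply: in_slice_seg => //.
  by rewrite big1 ?addn0 // => w; rewrite !inE; case: (w == u); case: (w == v).
have le : (\sum_(t < M.+1) mult H (seg u v c M t) <= size H)%N.
  by rewrite size_num; apply: (@mult_seg_le H u v c M xpredT) => // h hH _; apply: ne.
suff: (s.+1 * M.+1 <= defect s.+1 H u v c M + \sum_(t < M.+1) mult H (seg u v c M t))%N.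
  by move: le; lia.
rewrite -big_split /= -[X in (_ * X)%N]card_ord mulnC -sum_nat_const.
by apply: leq_sum => t _; rewrite addnC -leq_subLR.
Qed.

End Slices.

(** * The triangle *)

Lemma sum_shift_le (F : nat -> nat) (e m N : nat) : (e + m <= N)%N ->
  (\sum_(t < m) F (e + t) <= \sum_(t < N) F t)%N.
Proof.
move=> emN; have -> : (\sum_(t < m) F (e + t) = \sum_(e <= i < e + m) F i)%N.
  by rewrite -{2}[e]add0n big_addn addKn big_mkord; apply: eq_bigr => t _; rewrite addnC.
rewrite -(big_mkord xpredT F) (@big_cat_nat _ _ _ e 0 N) //=; last by lia.
by rewrite (@big_cat_nat _ _ _ (e + m) e N) ?leq_addr //=; lia.
Qed.

Section Triangle.
Variable R : realFieldType.
Implicit Types x y z r : R.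

Lemma sum_pred_le1 (n : nat) (P : pred nat) :
  (forall t t', (t < n)%N -> (t' < n)%N -> P t -> P t' -> t = t') ->
  (\sum_(t < n) (P t : nat) <= 1)%N.
Proof.
move=> inj; apply: sum_bool_le1 => t t' Pt Pt'; apply: val_inj.
exact: inj (ltn_ord t) (ltn_ord t') Pt Pt'.
Qed.

(* Going around the triangle, the sign at the corners would have to alternate
   along a cycle of odd length. *)
Lemma no_three_sides x y z r m t0 t1 t2 :
  0 <= t0 < m -> 0 <= t1 < m -> 0 <= t2 < m ->
  r + y * t0 + z * (m - t0) = 0 -> r + z * t1 + x * (m - t1) = 0 ->
  r + x * t2 + y * (m - t2) = 0 -> y = z.
Proof.
move=> /andP[t0p t0m] /andP[t1p t1m] /andP[t2p t2m] e0 e1 e2.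
have m0 : 0 < m by lra.
pose X := r + m * x; pose Y := r + m * y; pose Z := r + m * z.
have E0 : Y * t0 + Z * (m - t0) = 0 by rewrite -(mulr0 m) -e0 /Y /Z; ring.
have E1 : Z * t1 + X * (m - t1) = 0 by rewrite -(mulr0 m) -e1 /X /Z; ring.
have E2 : X * t2 + Y * (m - t2) = 0 by rewrite -(mulr0 m) -e2 /Y /X; ring.
suff YZ : Y = Z.
  by apply: (mulfI (lt0r_neq0 m0)); apply: (addrI r); rewrite -/Y -/Z.
have key (X' Y' Z' : R) : Y' * t0 + Z' * (m - t0) = 0 ->
    Z' * t1 + X' * (m - t1) = 0 -> X' * t2 + Y' * (m - t2) = 0 -> ~ (0 < Z').
  move=> F0 F1 F2 Zp.
  have Yn : Y' < 0 by rewrite ltNge; apply/negP => Yp; nra.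
  have Xp : 0 < X' by rewrite ltNge; apply/negP => Xn; nra.
  by nra.
have [Zn|Zp|Z0] := ltgtP Z 0.
- case: (key (- X) (- Y) (- Z)); last by rewrite oppr_gt0.
  + by rewrite !mulNr -opprD E0 oppr0.
  + by rewrite !mulNr -opprD E1 oppr0.
  + by rewrite !mulNr -opprD E2 oppr0.
- by case: (key X Y Z).
- have X0 : X = 0.
    apply/eqP; move: E1; rewrite Z0 mul0r add0r => /eqP.
    by rewrite mulf_eq0 subr_eq0 (gt_eqF t1m) orbF.
  apply/eqP; move: E2; rewrite X0 Z0 mul0r add0r => /eqP.
  by rewrite mulf_eq0 subr_eq0 (gt_eqF t2m) orbF.
Qed.

Lemma eq_lin (x y : R) (u v w : nat) s : x != y ->
  s + (x - y) * u%:R = 0 -> s + (x - y) * v%:R = 0 -> u = v.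
Proof.
move=> xy e1 e2; apply/eqP; rewrite -(eqr_nat R) -subr_eq0.
have /eqP: (x - y) * (u%:R - v%:R) = 0 by rewrite -(subrr (0:R)) -{1}e1 -e2; ring.
by rewrite mulf_eq0 !subr_eq0 (negPf xy).
Qed.

Definition side_hits x y z r (ea eb ed m : nat) : nat :=
  (\sum_(t < m) ((y != z) &&
     (r + x * ea%:R + y * (eb + t)%:R + z * (ed + (m - t))%:R == 0)%R))%N.

Definition layer_hits x y r (M e : nat) : nat :=
  (\sum_(c < e) (r + x * c%:R + y * (M - c)%:R == 0)%R)%N.

Lemma layer_hits_le1 x y r M e : x != y -> (e <= M.+1)%N -> (layer_hits x y r M e <= 1)%N.
Proof.
move=> xy eM; apply: (sum_pred_le1 (P := fun c => r + x * c%:R + y * (M - c)%:R == 0)).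
move=> t t' tM t'M /eqP e1 /eqP e2; apply: (@eq_lin x y _ _ 0 (r + y * M%:R)) => //.
  by rewrite -e1 natrB; [ring | lia].
by rewrite -e2 natrB; [ring | lia].
Qed.

Lemma side_hits_le1 x y z r ea eb ed m : (side_hits x y z r ea eb ed m <= 1)%N.
Proof.
rewrite /side_hits; have [->|yz] := eqVneq y z.
  by rewrite sum_nat_const muln0.
apply: (sum_pred_le1 (P := fun t =>
  r + x * ea%:R + y * (eb + t)%:R + z * (ed + (m - t))%:R == 0)).
move=> t t' tm t'm /eqP e1 /eqP e2.
apply: (@eq_lin y z _ _ 0 (r + x * ea%:R + y * eb%:R + z * (ed + m)%:R)) => //.
  by rewrite -e1 !natrD natrB; [ring | lia].
by rewrite -e2 !natrD natrB; [ring | lia].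
Qed.

Lemma side_hits0 x y z r ea eb ed m :
  (forall t, (t < m)%N ->
     r + x * ea%:R + y * (eb + t)%:R + z * (ed + (m - t))%:R <> 0) ->
  side_hits x y z r ea eb ed m = 0%N.
Proof.
move=> no; apply: big1 => t _; apply/eqP; rewrite eqb0 negb_and.
by apply/orP; right; apply/eqP/no.
Qed.

(* A line parallel to a side that was stripped off misses the triangle. *)
Lemma stripped_hits x y r ea eb ed m M : x != y -> M = (ea + eb + ed + m)%N ->
  (side_hits y y x r eb ed ea m + side_hits y x y r ed ea eb m
    + 2 * layer_hits x y r M ea <= 2)%N.
Proof.
move=> xy ME.
have L1 : (layer_hits x y r M ea <= 1)%N by apply: layer_hits_le1; lia.
have [L0|L0] := posnP (layer_hits x y r M ea).
  have := side_hits_le1 y y x r eb ed ea m; have := side_hits_le1 y x y r ed ea eb m.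
  by rewrite L0; lia.
have [c /eqP ec] : exists c : 'I_ea, r + x * c%:R + y * (M - c)%:R == 0.
  apply/existsP; apply: contraTT L0 => /existsPn no; rewrite -eqn0Ngt.
  by rewrite /layer_hits big1 // => c _; rewrite (negPf (no c)).
have cea := ltn_ord c.
have -> : side_hits y y x r eb ed ea m = 0%N.
  apply: side_hits0 => t tm e1.
  suff : (c : nat) = (ea + (m - t))%N by lia.
  apply: (@eq_lin x y _ _ 0 (r + y * M%:R)) => //.
    by rewrite -ec natrB; [ring | lia].
  by rewrite -e1 ME !natrD natrB; [ring | lia].
have -> : side_hits y x y r ed ea eb m = 0%N.
  apply: side_hits0 => t tm e1.
  suff : (c : nat) = (ea + t)%N by lia.
  apply: (@eq_lin x y _ _ 0 (r + y * M%:R)) => //.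
    by rewrite -ec natrB; [ring | lia].
  by rewrite -e1 ME !natrD natrB; [ring | lia].
lia.
Qed.

Lemma side_hits_pos x y z r ea eb ed m : (0 < side_hits x y z r ea eb ed m)%N ->
  exists2 t, (t < m)%N & r + x * ea%:R + y * (eb + t)%:R + z * (ed + (m - t))%:R = 0.
Proof.
move=> h; have /existsP[t /andP[_ /eqP e]] : [exists t : 'I_m, (y != z) &&
     (r + x * ea%:R + y * (eb + t)%:R + z * (ed + (m - t))%:R == 0)].
  apply: contraTT h => /existsPn no; rewrite -eqn0Ngt.
  by rewrite /side_hits big1 // => t _; rewrite (negPf (no t)).
by exists t.
Qed.

(** A plane parallel to a side is the case of [stripped_hits]. Any other plane meets each side at
    most once, and [no_three_sides] rules out all three. *)
Lemma triangle_hits x y z r ea eb ed m M : M = (ea + eb + ed + m)%N ->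
  ~~ ((x == y) && (y == z)) ->
  (side_hits x y z r ea eb ed m + side_hits y z x r eb ed ea m
     + side_hits z x y r ed ea eb m
   + 2 * ((y == z) * layer_hits x y r M ea + (z == x) * layer_hits y z r M eb
     + (x == y) * layer_hits z x r M ed) <= 2)%N.
Proof.
move=> ME; have side0 a b e1 e2 e3 : side_hits a b b r e1 e2 e3 m = 0%N.
  by rewrite /side_hits eqxx /= sum_nat_const muln0.
have [<-|yz] := eqVneq y z.
  rewrite andbT [y == x]eq_sym => xy; rewrite (negPf xy) side0 /=.
  by have := stripped_hits r xy ME; lia.
rewrite andbF => _; have [zx|zx] := eqVneq z x.
  have ME' : M = (eb + ed + ea + m)%N by lia.
  subst z; rewrite eq_sym (negPf yz) side0.
  by have := stripped_hits r yz ME'; lia.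
have [xy|xy] := eqVneq x y.
  have ME' : M = (ed + ea + eb + m)%N by lia.
  rewrite xy in zx *; rewrite side0.
  by have := stripped_hits r zx ME'; lia.
rewrite !mul0n !addn0.
have la := side_hits_le1 x y z r ea eb ed m.
have lb := side_hits_le1 y z x r eb ed ea m.
have ld := side_hits_le1 z x y r ed ea eb m.
have [a0|/side_hits_pos[t0 t0m e0]] := posnP (side_hits x y z r ea eb ed m).
  by rewrite a0; lia.
have [b0|/side_hits_pos[t1 t1m e1]] := posnP (side_hits y z x r eb ed ea m).
  by rewrite b0; lia.
have [d0|/side_hits_pos[t2 t2m e2]] := posnP (side_hits z x y r ed ea eb m).
  by rewrite d0; lia.
(* Moving the offsets into the constant term puts the inner triangle at the origin. *)
case/eqP: yz; pose s := r + x * ea%:R + y * eb%:R + z * ed%:R.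
apply: (@no_three_sides x y z s m%:R t0%:R t1%:R t2%:R).
- by rewrite ler0n ltr_nat.
- by rewrite ler0n ltr_nat.
- by rewrite ler0n ltr_nat.
- by rewrite -e0 /s !natrD natrB; [ring | lia].
- by rewrite -e1 /s !natrD natrB; [ring | lia].
- by rewrite -e2 /s !natrD natrB; [ring | lia].
Qed.
End Triangle.

Section TriangleDefect.
Variables (R : realFieldType) (T : finType).
Implicit Types (H : seq (plane R T)) (c : T -> nat) (a b d : T).

Definition pt3 c a b d xa xb xd : T -> nat :=
  fun w => if w == a then xa else if w == b then xb else if w == d then xd else c w.

Lemma pt3_rot c a b d xa xb xd : a != b -> b != d -> d != a ->
  pt3 c b d a xb xd xa =1 pt3 c a b d xa xb xd.
Proof.
move=> ab bd da w; rewrite /pt3.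
have [->|wa] := eqVneq w a; first by rewrite (negPf ab) eq_sym (negPf da).
by [].
Qed.

Lemma seg_pt3 c a b d xa N t : a != b -> d != a ->
  seg b d (upd c a xa) N t =1 pt3 c a b d xa t (N - t).
Proof.
move=> ab da w; rewrite /pt3 /seg /upd.
have [->|wa] := eqVneq w a; first by rewrite (negPf ab) eq_sym (negPf da).
by [].
Qed.

Lemma val_pt3 c a b d (h : plane R T) xa xb xd : a != b -> b != d -> d != a ->
  val_at h (pt3 c a b d xa xb xd) = val_at h (pt3 c a b d 0 0 0)
    + h.1 a * xa%:R + h.1 b * xb%:R + h.1 d * xd%:R.
Proof.
move=> ab bd da; rewrite /val_at.
have E ya yb yd : \sum_w h.1 w * (pt3 c a b d ya yb yd w)%:R =
    h.1 a * ya%:R + (h.1 b * yb%:R + (h.1 d * yd%:R +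
      \sum_(w | (w != a) && (w != b) && (w != d)) h.1 w * (c w)%:R)).
  rewrite (bigD1 a) //= (bigD1 b) 1?eq_sym //= (bigD1 d) ?da 1?eq_sym //=.
  rewrite /pt3 !eqxx [b == a]eq_sym (negPf ab) (negPf da) [d == b]eq_sym (negPf bd).
  congr (_ + (_ + (_ + _))).
  by apply: eq_bigr => w /andP[/andP[/negPf-> /negPf->] /negPf->].
by rewrite !E !mulr0 !add0r; ring.
Qed.

Definition layer H (r : plane R T -> R) a b d (M q : nat) : nat :=
  (\sum_(h <- H) (h.1 b == h.1 d) *
     (r h + h.1 a * q%:R + h.1 b * (M - q)%:R == 0)%R)%N.

Lemma sum_layer H r a b d M e :
  (\sum_(q < e) layer H r a b d M q =
   \sum_(h <- H) (h.1 b == h.1 d) * layer_hits (h.1 a) (h.1 b) (r h) M e)%N.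
Proof.
by rewrite exchange_big /=; apply: eq_bigr => h _; rewrite -big_distrr.
Qed.

(** At most two planes contain the side's layer, so two of the four incidences demanded at each
    point must come from transverse planes or count as defect. *)
Lemma side_defect H c a b d (r : plane R T -> R) ea eb ed m M :
  a != b -> b != d -> d != a ->
  (forall h xa xb xd, val_at h (pt3 c a b d xa xb xd) =
     r h + h.1 a * xa%:R + h.1 b * xb%:R + h.1 d * xd%:R) ->
  M = (ea + eb + ed + m)%N -> (layer H r a b d M ea <= 2)%N ->
  (2 * m <= defect 4 H b d (upd c a ea) (M - ea)
    + \sum_(h <- H) side_hits (h.1 a) (h.1 b) (h.1 d) (r h) ea eb ed m)%N.
Proof.
move=> ab bd da Hr ME lay.
have le : (\sum_(t < m) (4 - mult H (seg b d (upd c a ea) (M - ea) (eb + t)))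
           <= defect 4 H b d (upd c a ea) (M - ea))%N.
  apply: (@sum_shift_le (fun t => 4 - mult H (seg b d (upd c a ea) (M - ea) t))%N).
  by lia.
apply: leq_trans (leq_add le (leqnn _)).
rewrite exchange_big /= -big_split /= mulnC -{1}[m]card_ord -sum_nat_const.
apply: leq_sum => t _; have tm := ltn_ord t.
rewrite (mult_ext _ (seg_pt3 _ _ _ _ ab da)).
have -> : (M - ea - (eb + t) = ed + (m - t))%N by lia.
suff : (mult H (pt3 c a b d ea (eb + t) (ed + (m - t))) <= layer H r a b d M ea +
  \sum_(h <- H) ((h.1 b != h.1 d) && (r h + h.1 a * ea%:R + h.1 b * (eb + t)%:R
     + h.1 d * (ed + (m - t))%:R == 0)%R))%N by lia.
rewrite -big_split /=; apply: leq_sum => h _; rewrite /on Hr.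
have [e|ne] := eqVneq (h.1 b) (h.1 d); last by rewrite mul0n.
rewrite /= mul1n addn0 -e -addrA -mulrDr -natrD.
by have -> : (eb + t + (ed + (m - t)) = M - ea)%N by lia.
Qed.

Lemma card3P (W : {set T}) : #|W| = 3 -> exists a b d,
  [/\ a != b, b != d, d != a & W = [set a; b; d]].
Proof.
move=> W3; have /card_gt0P[a aW] : (0 < #|W|)%N by rewrite W3.
have W2 : #|W :\ a| == 2%N by move: W3; rewrite (cardsD1 a) aW add1n => -[->].
have [b [d [bd E]]] := cards2P _ W2.
have /setD1P[ba bW] : b \in W :\ a by rewrite E !inE eqxx.
have /setD1P[da dW] : d \in W :\ a by rewrite E !inE eqxx orbT.
exists a, b, d; split=> //; first by rewrite eq_sym.
by rewrite -[LHS](setD1K aW) E setUA.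
Qed.

Lemma seg_in3 c a b d ea M : a != b -> b != d -> d != a -> (ea <= M)%N ->
  seg_in [set a; b; d] c M b d (upd c a ea) (M - ea).
Proof.
move=> ab bd da eaM; split; rewrite ?inE ?eqxx ?orbT //.
move=> t tM; apply: in_slice_seg => //; rewrite ?inE ?eqxx ?orbT //.
  by move=> w; rewrite /upd !inE => /norP[/norP[/negPf-> _] _].
have -> : [set a; b; d] :\ b :\ d = [set a].
  apply/setP => w; rewrite !inE; have [->|wa] := eqVneq w a.
    by rewrite ab eq_sym da.
  by case: (w == b); case: (w == d).
by rewrite big_set1 /upd eqxx subnK.
Qed.

(* The first three layers with at most two planes bound a triangle; a plane meets
   at most two of its three half-open sides. *)
Lemma defect_bound_triangle : @defect_bound R T 2 3 4 3.
Proof.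
move=> W H c M /card3P[a [b [d [ab bd da ->]]]] nc.
apply: contrapT => /no_defect_bound small.
pose r (h : plane R T) := val_at h (pt3 c a b d 0 0 0).
have Hra h xa xb xd : val_at h (pt3 c a b d xa xb xd) =
    r h + h.1 a * xa%:R + h.1 b * xb%:R + h.1 d * xd%:R by apply: val_pt3.
have Hrb h xb xd xa : val_at h (pt3 c b d a xb xd xa) =
    r h + h.1 b * xb%:R + h.1 d * xd%:R + h.1 a * xa%:R.
  by rewrite (val_ext _ (pt3_rot _ _ _ _ ab bd da)) Hra; ring.
have Hrd h xd xa xb : val_at h (pt3 c d a b xd xa xb) =
    r h + h.1 d * xd%:R + h.1 a * xa%:R + h.1 b * xb%:R.
  by rewrite (val_ext _ (pt3_rot _ _ _ _ bd da ab)) Hrb; ring.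
have [ea [eaM la La]] := least_below (layer H r a b d M) 2 M.+1.
have [eb [ebM lb Lb]] := least_below (layer H r b d a M) 2 M.+1.
have [ed [edM ld Ld]] := least_below (layer H r d a b M) 2 M.+1.
have strip u v w e : (forall q, (q < e)%N -> (2 < layer H r u v w M q)%N) ->
    (3 * e <= \sum_(h <- H) (h.1 v == h.1 w) * layer_hits (h.1 u) (h.1 v) (r h) M e)%N.
  move=> L; rewrite -sum_layer mulnC -{1}[e]card_ord -sum_nat_const.
  by apply: leq_sum => q _; apply: L.
have sa := strip _ _ _ _ La; have sb := strip _ _ _ _ Lb; have sd := strip _ _ _ _ Ld.
have nconst h : h \in H -> ~~ ((h.1 a == h.1 b) && (h.1 b == h.1 d)).
  move=> /nc; apply: contraTN => /andP[/eqP xy /eqP yz]; apply/constP => u v.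
  by rewrite !inE -!orbA => /or3P[] /eqP-> /or3P[] /eqP->; rewrite ?xy ?yz.
have line := small _ _ _ _ (seg_in3 c ab bd da (leq0n M)).
(* If the stripped layers outnumber [M], they suffice alone: each holds three planes, and no plane
   counts in two layers or for two directions. *)
have [big|small3] := ltnP M (ea + eb + ed).
  suff : (3 * (ea + eb + ed) <= size H)%N by lia.
  rewrite !mulnDr; apply: leq_trans (leq_add (leq_add sa sb) sd) _.
  rewrite -sum1_size -!big_split /=; apply: sum_planes => h /nconst nch.
  have lay u v e : u != v -> (e <= M.+1)%N -> (layer_hits u v (r h) M e <= 1)%N.
    exact: layer_hits_le1.
  have [yz|yz] := eqVneq (h.1 b) (h.1 d).
    rewrite -yz eqxx andbT in nch *.
    by rewrite [h.1 b == h.1 a]eq_sym (negPf nch) mul1n !mul0n !addn0 lay.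
  have [zx|zx] := eqVneq (h.1 d) (h.1 a).
    by rewrite -zx [h.1 d == h.1 b]eq_sym (negPf yz) mul1n !mul0n addn0 lay.
  have [xy|xy] := eqVneq (h.1 a) (h.1 b); last by rewrite !mul0n.
  by rewrite !mul0n !add0n mul1n lay // -xy.
pose m := (M - (ea + eb + ed))%N.
have MEa : M = (ea + eb + ed + m)%N by lia.
have MEb : M = (eb + ed + ea + m)%N by lia.
have MEd : M = (ed + ea + eb + m)%N by lia.
have da' := side_defect ab bd da Hra MEa (la _).
have db' := side_defect bd da ab Hrb MEb (lb _).
have dd' := side_defect da ab bd Hrd MEd (ld _).
have hits : (\sum_(h <- H) side_hits (h.1 a) (h.1 b) (h.1 d) (r h) ea eb ed m
   + \sum_(h <- H) side_hits (h.1 b) (h.1 d) (h.1 a) (r h) eb ed ea m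
   + \sum_(h <- H) side_hits (h.1 d) (h.1 a) (h.1 b) (r h) ed ea eb m
   + 2 * (3 * ea + 3 * eb + 3 * ed) <= 2 * size H)%N.
  apply: leq_trans (leq_add (leqnn _) (leq_mul (leqnn 2) (leq_add (leq_add sa sb) sd))) _.
  rewrite -sum1_size !big_distrr /= -!big_split /= big_distrr -big_split /=.
  by apply: sum_planes => h /nconst nch; rewrite muln1; apply: triangle_hits.
have Ea : (ea <= M)%N by lia.
have Eb : (eb <= M)%N by lia.
have Ed : (ed <= M)%N by lia.
have Sa := small _ _ _ _ (seg_in3 c ab bd da Ea).
have Sb := seg_in3 c bd da ab Eb; have Sd := seg_in3 c da ab bd Ed.
have sb' : [set b; d; a] = [set a; b; d].
  by apply/setP => w; rewrite !inE; case: (w == a); case: (w == b); case: (w == d).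
have sd' : [set d; a; b] = [set a; b; d].
  by apply/setP => w; rewrite !inE; case: (w == a); case: (w == b); case: (w == d).
rewrite sb' in Sb; rewrite sd' in Sd.
have {}Sb := small _ _ _ _ Sb; have {}Sd := small _ _ _ _ Sd.
(* The three sides give [6 * M] at most the sum of their defects plus [2 * size H]. As [small] keeps
   each [size H + 2 * defect] below [3 * M], this forces [3 * M < size H], against [line]. *)
lia.
Qed.
End TriangleDefect.

(** * The induction step for defects *)

Lemma nat_hit (P : pred nat) m n : (0 < \sum_(m <= t < n) P t)%N ->
  exists t, [/\ (m <= t)%N, (t < n)%N & P t].
Proof.
move=> pos; apply: contrapT => no; move: pos; rewrite big_nat big1 // => t /andP[mt tn].
by case Pt: (P t) => //; case: no; exists t.
Qed.

Lemma nat_hit_le1 (P : pred nat) m n :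
  (forall t t', (m <= t < n)%N -> (m <= t' < n)%N -> P t -> P t' -> t = t') ->
  (\sum_(m <= t < n) P t <= 1)%N.
Proof.
move=> inj; rewrite -[m]add0n big_addn big_mkord.
apply: (sum_pred_le1 (P := fun t => P (t + m)%N)) => t t' tn t'n Pt Pt'.
by apply/eqP; rewrite -(eqn_add2r m); apply/eqP; apply: inj => //; lia.
Qed.

Section Perimeter.
Variables (R : realFieldType) (r al be : R) (t1 t2 q1 q2 : nat).

Definition hit t q : bool := r + al * t%:R + be * q%:R == 0.

(** The sign of [al * be] decides whether the line is decreasing or increasing. *)
Lemma hit_tq t t' q q' : al != 0 -> be != 0 -> hit t q -> hit t' q' ->
  al * be * (t%:R - t'%:R) * (q%:R - q'%:R) <= 0 /\
  ((t == t') = (q == q')).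
Proof.
move=> al0 be0 /eqP e /eqP e'.
have E : al * (t%:R - t'%:R) = - (be * (q%:R - q'%:R)).
  apply/eqP; rewrite -subr_eq0 -[eqbRHS](subrr (0 : R)) -{1}e -e'.
  by apply/eqP; ring.
split.
  have -> : al * be * (t%:R - t'%:R) * (q%:R - q'%:R) =
      (al * (t%:R - t'%:R)) * (be * (q%:R - q'%:R)) by ring.
  by rewrite E mulNr oppr_le0 -expr2 sqr_ge0.
rewrite -(eqr_nat R t) -(eqr_nat R q) -subr_eq0 -[RHS]subr_eq0.
by rewrite -[LHS](mulrI_eq0 _ (lregP al0)) E oppr_eq0 (mulrI_eq0 _ (lregP be0)).
Qed.

(* The corners belong to the vertical sides only.  Of a vertical side and the
   horizontal side that continues it, an increasing line meets at most one if they
   meet at the bottom left or at the top right corner; a decreasing line, at the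
   other two. *)
Lemma perimeter_hits : al != 0 -> be != 0 ->
  (\sum_(q1 <= q < q2.+1) hit t1 q + \sum_(q1 <= q < q2.+1) hit t2 q
   + \sum_(t1.+1 <= t < t2) hit t q1 + \sum_(t1.+1 <= t < t2) hit t q2 <= 2)%N.
Proof.
move=> al0 be0.
have vert t : (\sum_(q1 <= q < q2.+1) hit t q <= 1)%N.
  apply: (nat_hit_le1 (P := hit t)) => q q' _ _ h h'.
  by have [_] := hit_tq al0 be0 h h'; rewrite eqxx => /esym/eqP.
have horiz q : (\sum_(t1.+1 <= t < t2) hit t q <= 1)%N.
  apply: (nat_hit_le1 (P := fun t => hit t q)) => t t' _ _ h h'.
  by have [_] := hit_tq al0 be0 h h'; rewrite eqxx => /eqP.
have key t q : (forall t' q', (t1 < t' < t2)%N -> (q1 <= q' <= q2)%N ->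
      hit t q' -> hit t' q -> False) ->
    (\sum_(q1 <= q' < q2.+1) hit t q' + \sum_(t1.+1 <= t' < t2) hit t' q <= 1)%N.
  move=> no.
  have [v0|/nat_hit[q' [q'1 q'2 h]]] := posnP (\sum_(q1 <= q' < q2.+1) hit t q')%N.
    by rewrite v0 horiz.
  have [w0|/nat_hit[t' [t'1 t'2 h']]] := posnP (\sum_(t1.+1 <= t' < t2) hit t' q)%N.
    by rewrite w0 addn0 vert.
  by case: (no t' q') => //; lia.
have prod (u v x y : nat) : (u < v)%N -> (x < y)%N -> 0 < (u%:R - v%:R) * (x%:R - y%:R) :> R.
  move=> uv xy; have -> : (u%:R - v%:R) * (x%:R - y%:R) = (v%:R - u%:R) * (y%:R - x%:R) :> R by ring.
  by rewrite mulr_gt0 // subr_gt0 ltr_nat.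
have incr u v x y : hit u x -> hit v y -> (u < v)%N -> (x <= y)%N -> ~ 0 < al * be.
  move=> h h' uv xy p; have [] := hit_tq al0 be0 h h'; rewrite leNgt => /negP le eqv.
  by apply: le; rewrite -mulrA mulr_gt0 // prod // ltn_neqAle xy -eqv neq_ltn uv.
have decr u v x y : hit u x -> hit v y -> (u < v)%N -> (y <= x)%N -> ~ al * be < 0.
  move=> h h' uv xy p; have [] := hit_tq al0 be0 h h'; rewrite leNgt => /negP le eqv.
  apply: le; rewrite -mulrA nmulr_rgt0 // -oppr_gt0 -mulrN opprB prod //.
  by rewrite ltn_neqAle xy eq_sym -eqv neq_ltn uv.
have [neg|pos|/eqP] := ltgtP (al * be) 0; last by rewrite mulf_eq0 (negPf al0) (negPf be0).
- have lb := key t1 q1; have rt := key t2 q2.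
  have {}lb : (\sum_(q1 <= q' < q2.+1) hit t1 q' + \sum_(t1.+1 <= t' < t2) hit t' q1 <= 1)%N.
    by apply: lb => t' q' tt qq h h'; apply: (decr _ _ _ _ h h') => //; lia.
  have {}rt : (\sum_(q1 <= q' < q2.+1) hit t2 q' + \sum_(t1.+1 <= t' < t2) hit t' q2 <= 1)%N.
    by apply: rt => t' q' tt qq h h'; apply: (decr _ _ _ _ h' h) => //; lia.
  lia.
- have lt := key t1 q2; have rb := key t2 q1.
  have {}lt : (\sum_(q1 <= q' < q2.+1) hit t1 q' + \sum_(t1.+1 <= t' < t2) hit t' q2 <= 1)%N.
    by apply: lt => t' q' tt qq h h'; apply: (incr _ _ _ _ h h') => //; lia.
  have {}rb : (\sum_(q1 <= q' < q2.+1) hit t2 q' + \sum_(t1.+1 <= t' < t2) hit t' q1 <= 1)%N.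
    by apply: rb => t' q' tt qq h h'; apply: (incr _ _ _ _ h' h) => //; lia.
  lia.
Qed.
End Perimeter.

(** * Layers of a pair of vertices, and rectangles inside them *)

Section Layers.
Variables (R : realFieldType) (T : finType) (W : {set T}) (c : T -> nat) (M : nat).
Variables (i j : T) (iW : i \in W) (jW : j \in W) (ij : i != j).
Implicit Types (h : plane R T) (x y : T -> nat).
Local Notation J := (W :\ i :\ j).

Lemma in_slice_ext (V : {set T}) c0 N x y : x =1 y -> in_slice V c0 N x -> in_slice V c0 N y.
Proof.
move=> xy [xc xN]; split=> [v vV|]; first by rewrite -xy xc.
by rewrite -xN; apply: eq_bigr => v _; rewrite xy.
Qed.

Lemma sum_rest x : (\sum_(v in W) x v = x i + x j + \sum_(v in J) x v)%N.
Proof. by rewrite (big_setD1 i) //= (big_setD1 j) ?addnA // !inE eq_sym ij. Qed.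

Lemma in_restP v : reflect [/\ v != i, v != j & v \in W] (v \in J).
Proof. by rewrite !inE; apply: (iffP and3P) => -[]. Qed.

Lemma in_layer z t x : (z <= M)%N -> (t <= z)%N ->
  in_slice J (seg i j c z t) (M - z) x ->
  [/\ in_slice W c M x, x i = t & x j = (z - t)%N].
Proof.
move=> zM tz [xc xM].
have xi : x i = t by rewrite xc ?inE ?eqxx ?andbF // /seg eqxx.
have xj : x j = (z - t)%N by rewrite xc ?inE ?eqxx // /seg [j == i]eq_sym (negPf ij) eqxx.
split=> //; split=> [v vW|]; last by rewrite sum_rest xi xj xM; lia.
rewrite xc; last by apply/in_restP => -[_ _ vW']; rewrite vW' in vW.
by rewrite /seg !ifN //; apply: contraNneq vW => ->.
Qed.

Lemma seg_in_layer z t u v c' M' : (z <= M)%N -> (t <= z)%N ->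
  seg_in J (seg i j c z t) (M - z) u v c' M' -> seg_in W c M u v c' M'.
Proof.
move=> zM tz [/in_restP[_ _ uW] /in_restP[_ _ vW] uv sg]; split=> // q qM.
by have [] := in_layer zM tz (sg q qM).
Qed.

Lemma layer_const h x y : h.1 i = h.1 j -> ~~ nonconst J h ->
  in_slice W c M x -> in_slice W c M y -> (x i + x j = y i + y j)%N ->
  on h x = on h y.
Proof.
move=> hij nJ [xc xM] [yc yM] E.
have ji : (j == i) = false by rewrite eq_sym (negPf ij).
(* The point [y'] has the coordinates of [x] on the pair and those of [y] elsewhere; each half of
   the move stays within a set on which [h] has constant coefficients. *)
pose y' := seg i j y (y i + y j) (x i).
have iE : i \notin [set j] by rewrite inE.
have sE (F : T -> nat) : (\sum_(v in [set i; j]) F v = F i + F j)%N.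
  by rewrite big_setU1 //= big_set1.
rewrite (@on_const _ _ [set i; j] y (y i + y j) h y y'); last 1 first.
- split=> [v|]; first by rewrite !inE => /norP[/negPf vi /negPf vj]; rewrite /y' /seg vi vj.
  by rewrite sE /y' /seg !eqxx ji; lia.
- apply: (on_const (W := J) (c := x) (M := \sum_(v in J) x v)) => //; split=> // [v|].
    rewrite /y' /seg; have [->//|vi] := eqVneq v i.
    have [->|vj] := eqVneq v j; first by lia.
    rewrite !inE vi vj /= => vW; by rewrite xc // yc.
  move: xM; rewrite -yM !sum_rest E => /addnI->.
  by apply: eq_bigr => v /in_restP[vi vj _]; rewrite /y' /seg (negPf vi) (negPf vj).
- by apply/constP => u v; rewrite !inE => /orP[] /eqP-> /orP[] /eqP->.
- by split; rewrite ?sE.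
Qed.

Section Rectangle.
Variables (z : nat) (l l' : T) (c' : T -> nat) (M' : nat).
Variable zM : (z <= M)%N.
Variable sg : seg_in J (seg i j c z 0) (M - z) l l' c' M'.

Lemma grid_swap t q :
  seg i j (seg l l' c' M' q) z t =1 seg l l' (seg i j c' z t) M' q.
Proof.
case: sg => /in_restP[li lj _] /in_restP[l'i l'j _] _ _ w; rewrite /seg.
have [->|wi] := eqVneq w i; first by rewrite ![i == _]eq_sym (negPf li) (negPf l'i).
by have [->|wj] := eqVneq w j; first by rewrite ![j == _]eq_sym (negPf lj) (negPf l'j).
Qed.

Lemma grid_base q : (q <= M')%N -> seg i j (seg l l' c' M' q) z 0 =1 seg l l' c' M' q.
Proof.
move=> qM w; case: sg => _ _ _ /(_ q qM)[xc _].
rewrite {1}/seg; have [->|wi] := eqVneq w i.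
  by rewrite xc ?inE ?eqxx ?andbF // /seg eqxx.
have [->|//] := eqVneq w j.
by rewrite xc ?inE ?eqxx // /seg [j == i]eq_sym (negPf ij) eqxx.
Qed.

Lemma grid_col t : (t <= z)%N ->
  seg_in J (seg i j c z t) (M - z) l l' (seg i j c' z t) M'.
Proof.
move=> tz; case: sg => lJ l'J ll' S; split=> // q qM.
apply: (in_slice_ext (grid_swap t q)); have [xc xM] := S q qM; split=> [v|].
  move=> vJ; rewrite {1}/seg [in RHS]/seg; have [//|vi] := eqVneq v i.
  have [//|vj] := eqVneq v j; rewrite xc // /seg (negPf vi) (negPf vj) //.
by rewrite -xM; apply: eq_bigr => v /in_restP[vi vj _]; rewrite {1}/seg (negPf vi) (negPf vj).
Qed.

Lemma grid_row q : (q <= M')%N -> seg_in W c M i j (seg l l' c' M' q) z.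
Proof.
move=> qM; split=> // t tz; apply: (in_slice_ext (fsym (grid_swap t q))).
have [_ _ _ S] := grid_col tz; by have [] := in_layer zM tz (S q qM).
Qed.

Lemma val_grid h t q : (t <= z)%N -> (q <= M')%N ->
  val_at h (seg i j (seg l l' c' M' q) z t) =
  val_at h (seg l l' c' M' 0) + (h.1 i - h.1 j) * t%:R + (h.1 l - h.1 l') * q%:R.
Proof.
move=> tz qM; have [_ _ ll' _] := sg.
by rewrite val_seg // (val_ext _ (grid_base qM)) val_seg // addrAC.
Qed.
End Rectangle.
End Layers.

Lemma extremes (P : pred nat) N q0 : (q0 <= N)%N -> P q0 ->
  exists q1 q2, [/\ (q1 <= q2 <= N)%N, P q1, P q2 &
    forall q, (q <= N)%N -> P q -> (q1 <= q <= q2)%N].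
Proof.
move=> q0N Pq0; have ex : exists q, (q <= N)%N && P q by exists q0; rewrite q0N.
have ub q : (q <= N)%N && P q -> (q <= N)%N by case/andP.
case: (ex_minnP ex) => q1 /andP[q1N Pq1] q1min.
case: (ex_maxnP ex ub) => q2 /andP[q2N Pq2] q2max.
exists q1, q2; split=> // [|q qN Pq]; last by rewrite q1min ?q2max // qN.
by rewrite q2N q1min ?q2N.
Qed.

Lemma sum_range_le (F : nat -> nat) m n N : (n <= N)%N ->
  (\sum_(m <= t < n) F t <= \sum_(t < N) F t)%N.
Proof.
move=> nN; rewrite -(big_mkord xpredT F); have [mn|nm] := leqP m n; last first.
  by rewrite big_geq // ltnW.
rewrite (@big_cat_nat _ _ _ m 0 N) //= 1?(@big_cat_nat _ _ _ n m N) //=; lia.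
Qed.

Lemma sum_range_supp (F : nat -> nat) m n N : (m <= n <= N)%N ->
  (forall t, (t < N)%N -> (0 < F t)%N -> (m <= t < n)%N) ->
  (\sum_(t < N) F t = \sum_(m <= t < n) F t)%N.
Proof.
move=> /andP[mn nN] supp; rewrite -(big_mkord xpredT F).
have z0 a b : (b <= N)%N -> ((b <= m) || (n <= a))%N -> (\sum_(a <= t < b) F t = 0)%N.
  move=> bN out; rewrite big_nat big1 // => t /andP[at_ tb].
  by apply/eqP; rewrite eqn0Ngt; apply/negP => /supp; lia.
rewrite (@big_cat_nat _ _ _ m 0 N) //=; last by lia.
rewrite (@big_cat_nat _ _ _ n m N) //= (z0 0%N m) ?(z0 n N) ?add0n ?addn0 ?leqnn ?orbT //.
all: lia.
Qed.

Lemma sum_pos_term (F : nat -> nat) N : (0 < \sum_(t < N) F t)%N ->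
  exists2 t, (t < N)%N & (0 < F t)%N.
Proof.
move=> pos; have [|t Ft] := @exists_le_of_sum _ (fun=> 0%N) (fun t : 'I_N => F t).
  by rewrite big1.
by exists t.
Qed.

Lemma layer_split C z M : (z <= M)%N -> (C * M.+1 = C * (M - z) + C * z.+1)%N.
Proof. by move=> zM; rewrite -mulnDr; congr muln; lia. Qed.

(** [C], [X], [Y] stand for [s.+1], [s.+1 * (M - z)], [s.+1 * z.+1]; [c1], [c2], [r1], [r2] are the
    defects of two columns and two rows, and the [p] terms the incidences of oblique planes with the
    perimeter. The slack 9 absorbs the [2 * C] lost at the corners. *)
Lemma rectangle_arith C V B P d K X Y As Ai Bs (c1 c2 r1 r2 p1 p2 p3 p4 : nat) :
  (C <= 3)%N -> (X <= B + K + 2 * d)%N -> (C + X <= B + 2 * Bs + K)%N ->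
  (Y <= V + As)%N -> (As <= Ai + 2 * C)%N ->
  (Bs <= c1 + p1)%N -> (Bs <= c2 + p2)%N -> (Ai <= r1 + p3)%N -> (Ai <= r2 + p4)%N ->
  (p1 + p2 + p3 + p4 <= 2 * P)%N ->
  (V + B + P + d + 2 * c1 + (K + 9) < X + Y)%N ->
  (V + B + P + d + 2 * c2 + (K + 9) < X + Y)%N ->
  (V + B + P + d + 2 * r1 + (K + 9) < X + Y)%N ->
  (V + B + P + d + 2 * r2 + (K + 9) < X + Y)%N -> False.
Proof. lia. Qed.

Section Step.
Variables (R : realFieldType) (T : finType).
Implicit Types (h : plane R T) (W : {set T}) (x y : T -> nat).

Lemma mult_filter (P : pred (plane R T)) H x :
  mult (filter P H) x = (\sum_(h <- H) (P h && on h x))%N.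
Proof. by rewrite /mult big_filter big_mkcond; apply: eq_bigr => h _; case: (P h). Qed.

Lemma size_filter_num (P : pred (plane R T)) H : size (filter P H) = num H P.
Proof. by rewrite size_num /num big_filter big_mkcond; apply: eq_bigr => h _; case: (P h). Qed.

Lemma num_le H (P Q : pred (plane R T)) :
  {in H, forall h, P h -> Q h} -> (num H P <= num H Q)%N.
Proof. by move=> PQ; apply: sum_planes => h hH; case Ph: (P h) => //; rewrite PQ. Qed.

Section Pair.
Variables (W : {set T}) (i j : T).
Local Notation J := (W :\ i :\ j).

(** In a layer, the product of a segment and a smaller simplex, [pairA] planes consist of whole
    columns over a point of the segment, [pairB] planes are parallel to the segment, [pairO] planes
    are oblique, and a [pairD] plane contains the layer or misses it. *)
Definition pairA h := (h.1 i != h.1 j) && ~~ nonconst J h.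
Definition pairB h := (h.1 i == h.1 j) && nonconst J h.
Definition pairO h := (h.1 i != h.1 j) && nonconst J h.
Definition pairD h := (h.1 i == h.1 j) && ~~ nonconst J h.

Lemma size_pair H :
  size H = (num H pairA + num H pairB + num H pairO + num H pairD)%N.
Proof.
rewrite size_num /num -!big_split; apply: eq_bigr => h _ /=.
by rewrite /pairA /pairB /pairO /pairD; case: (h.1 i == h.1 j); case: (nonconst J h).
Qed.
End Pair.

Lemma pairD_ne W i l h v : nonconst W h -> pairD W i l h ->
  v \in W :\ i :\ l -> h.1 v != h.1 i.
Proof.
move=> ncW /andP[/eqP hil /constP cst] vil; apply: contraTneq ncW => hvi.
have all u : u \in W -> h.1 u = h.1 i.
  move=> uW; have [->//|ui] := eqVneq u i; have [->//|ul] := eqVneq u l.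
  by rewrite -hvi; apply: cst; rewrite // !inE ui ul.
by apply/constP => u u' uW u'W; rewrite !all.
Qed.

Section Layer.
Variables (s w k K' : nat) (IH : @defect_bound R T s w k K').
Variables (W : {set T}) (H : seq (plane R T)) (c : T -> nat) (M : nat).
Variables (i j : T) (iW : i \in W) (jW : j \in W) (ij : i != j).
Local Notation J := (W :\ i :\ j).
Variables (cardJ : #|J| = w) (w0 : (0 < w)%N).
Variable small : forall u v c' M', seg_in W c M u v c' M' ->
  (size H + 2 * defect (k + s) H u v c' M' + (K' + 9) < s.+1 * M.+1)%N.
Variable z : nat.
Variables (zM : (z <= M)%N) (free : {in H, forall h, pairD W i j h ->
  forall x, in_slice W c M x -> (x i + x j = z)%N -> ~~ on h x}).

Lemma J_ij l : l \in J -> [/\ l != i, l != j & l \in W].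
Proof. by move/in_restP. Qed.

(** One reference point per column, all on a single segment, so that the columns inside [pairA]
    planes can be counted along it. *)
Lemma column_ref : exists c0, forall t, (t <= z)%N ->
  in_slice J (seg i j c z t) (M - z) (seg i j c0 z t).
Proof.
have /card_gt0P[l lJ] : (0 < #|J|)%N by rewrite cardJ.
have [li lj lW] := J_ij lJ.
exists (fun v => if v == l then M - z else if v \in W then 0 else c v)%N => t tz; split.
  move=> v vJ; rewrite /seg; have [//|vi] := eqVneq v i; have [//|vj] := eqVneq v j.
  have vW : v \notin W by move: vJ; rewrite !inE vi vj.
  by rewrite (negPf vW) ifN //; apply: contraNneq vW => ->.
rewrite (big_setD1 l) //= big1 ?addn0; first by rewrite /seg (negPf li) (negPf lj) eqxx.
move=> v /setD1P[vl /J_ij[vi vj vW]].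
by rewrite /seg (negPf vi) (negPf vj) (negPf vl) vW.
Qed.

(** In a column with at most [s] planes of type [pairA], the other planes face a demand of at least
    [k] out of [k + s]; the line given there by [IH] is then compared with [small]. *)
Lemma free_layer_lower : (num H (pairA W i j) < s.+1 * z.+1)%N ->
  (num H (pairA W i j) + num H (pairD W i j) + 9 < s.+1 * z)%N.
Proof.
move=> Asmall; have [c0 ref] := column_ref.
(* A [pairA] plane holds at most one column, so some column lies in at most [s] of them. *)
have [|t] := @exists_le_of_sum _
    (fun t : 'I_z.+1 => \sum_(h <- H) (pairA W i j h && on h (seg i j c0 z t)))%N
    (fun=> s.+1).
  rewrite sum_nat_const card_ord mulnC; apply: leq_ltn_trans Asmall.
  by apply: mult_seg_le => // h _ /andP[].
have tz : (t <= z)%N by rewrite -ltnS.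
rewrite ltnS => colA.
have ncJ : {in filter (nonconst J) H, forall h, nonconst J h}.
  by move=> h; rewrite mem_filter => /andP[].
have [u [v [c' [M' [sg le]]]]] := IH (seg i j c z t) (M - z)%N cardJ ncJ.
have line := small (seg_in_layer iW jW ij zM tz sg).
have def : (defect k (filter (nonconst J) H) u v c' M' <= defect (k + s) H u v c' M')%N.
  apply: leq_sum => q _; case: sg => _ _ _ /(_ q); rewrite -ltnS ltn_ord => /(_ isT) xin.
  suff : (mult H (seg u v c' M' q) <= s + mult (filter (nonconst J) H) (seg u v c' M' q))%N.
    by lia.
  apply: leq_trans (leq_add colA (leqnn _)); rewrite mult_filter -big_split.
  apply: sum_planes => h hH /=; have [nJ|nJ] := boolP (nonconst J h); first by rewrite leq_addl.
  rewrite addn0 /pairA nJ andbT (on_const nJ xin (ref _ tz)).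
  have [hij|//] := eqVneq (h.1 i) (h.1 j).
  have [xW xi xj] := in_layer iW jW ij zM tz (ref _ tz).
  by rewrite (negPf (free hH _ xW _)) //; [rewrite /pairD hij eqxx nJ | lia].
have sF : size (filter (nonconst J) H) = (num H (pairB W i j) + num H (pairO W i j))%N.
  rewrite size_filter_num /num -big_split; apply: eq_bigr => h _ /=.
  by rewrite /pairB /pairO; case: (_ == _); rewrite ?addn0.
move: line le (layer_split s.+1 zM) def; rewrite sF (size_pair W i j H) !mulnS; clear; lia.
Qed.

Variables (s2 : (s <= 2)%N) (ncW : {in H, forall h, nonconst W h}).
Variable pair_min : forall i' j', i' \in W -> j' \in W -> i' != j' ->
  (num H (pairD W i j) <= num H (pairD W i' j'))%N.

(** [IH] for the [pairB] planes alone gives a line of the second factor on which they fall short.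
    Over this line and the segment, two columns and two rows bound a rectangle whose perimeter an
    oblique plane meets at most twice, so one of the four has too large a defect. *)
Lemma free_layer_upper :
  (num H (pairB W i j) + K' < s.+1 * (M - z).+1)%N ->
  (num H (pairB W i j) + K' + 2 * num H (pairD W i j) < s.+1 * (M - z))%N.
Proof.
move=> Bsmall; rewrite ltnNge; apply/negP => Bbig.
have ncB : {in filter (pairB W i j) H, forall h, nonconst J h}.
  by move=> h; rewrite mem_filter => /andP[/andP[]].
have [l [l' [c' [M' [sg le]]]]] := IH (seg i j c z 0) (M - z)%N cardJ ncB.
have [lJ l'J ll' _] := sg.
have [li lj lW] := J_ij lJ; have [l'i l'j l'W] := J_ij l'J.
pose g t q := seg i j (seg l l' c' M' q) z t.
pose G h := hit (val_at h (seg l l' c' M' 0)) (h.1 i - h.1 j) (h.1 l - h.1 l').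
have onG h t q : (t <= z)%N -> (q <= M')%N -> on h (g t q) = G h t q.
  by move=> tz qM; rewrite /on (val_grid ij sg).
have g_slice t q : (t <= z)%N -> (q <= M')%N ->
    in_slice W c M (g t q) /\ (g t q i + g t q j = z)%N.
  move=> tz qM; have [_ _ _ /(_ t tz) S] := grid_row iW jW ij zM sg qM.
  by split=> //; rewrite /g /seg !eqxx [j == i]eq_sym (negPf ij) subnKC.
pose V h := (h.1 i != h.1 j) && (h.1 l == h.1 l').
pose P h := (h.1 i != h.1 j) && (h.1 l != h.1 l').
pose kV t := (\sum_(h <- H) (V h && on h (g t 0)))%N.
pose kB q := (\sum_(h <- H) (pairB W i j h && on h (g 0 q)))%N.
pose kP t q := (\sum_(h <- H) (P h && on h (g t q)))%N.
have multE t q : (t <= z)%N -> (q <= M')%N ->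
    (mult H (g t q) <= kV t + kB q + kP t q)%N.
  move=> tz qM; rewrite /kV /kB /kP -!big_split; apply: sum_planes => h hH /=.
  have [S E] := g_slice _ _ tz qM; rewrite /V /P /pairB.
  have [hij|hij] /= := eqVneq (h.1 i) (h.1 j); last first.
    have [hl|hl] /= := eqVneq (h.1 l) (h.1 l'); last by rewrite leq_addl.
    by rewrite !addn0 !onG // /G hl /hit subrr !mul0r.
  have [nJ|nJ] /= := boolP (nonconst J h); last first.
    by rewrite (negPf (free hH _ S E)) // /pairD hij eqxx.
  by rewrite !addn0 !onG // /G hij /hit subrr !mul0r.
have sizeE : size H = (num H V + num H (pairB W i j) + num H P + num H (pairD W i j))%N.
  rewrite size_num /num -!big_split; apply: eq_bigr => h _ /=.
  rewrite /V /P /pairB /pairD.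
  by case: (_ i == _); case: (_ l == _); case: (nonconst J h).
(* Minimality of the pair: a [pairD] plane for [i], [l] separates [i] from [j] and [l] from [l']. *)
have Pbig : (num H (pairD W i j) <= num H P)%N.
  apply: leq_trans (pair_min iW lW _) (num_le _); first by rewrite eq_sym.
  move=> h hH Dh; have ne := pairD_ne (ncW hH) Dh.
  case/andP: (Dh) => /eqP hil _; rewrite /P -hil [_ == h.1 j]eq_sym [_ == h.1 l']eq_sym.
  by rewrite !ne // !inE ?l'i ?l'W ?jW ?andbT [_ == l]eq_sym ?ll' ?lj //= eq_sym.
have E := layer_split s.+1 zM.
(* The two demands [s.+1] and [k] exceed [k + s] by one. Still, [0 < a t] leaves a demand of at
   least [k] on column [t], and [0 < b q] one of at least [s.+1] on row [q]. *)
pose a t := (s.+1 - kV t)%N; pose b q := (k - kB q)%N.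
have VA : (s.+1 * z.+1 <= num H V + \sum_(t < z.+1) a t)%N.
  have leV : (\sum_(t < z.+1) kV t <= num H V)%N.
    by apply: (@mult_seg_le _ _ H i j (seg l l' c' M' 0) z V) => // h _ /andP[].
  apply: leq_trans (leq_add leV (leqnn _)); rewrite -big_split /=.
  rewrite -[X in (_ * X)%N]card_ord mulnC -sum_nat_const.
  by apply: leq_sum => t _; rewrite -leq_subLR.
have BD : (\sum_(q < M'.+1) b q = defect k (filter (pairB W i j) H) l l' c' M')%N.
  apply: eq_bigr => q _; congr (_ - _)%N; rewrite mult_filter; apply: eq_bigr => h _.
  by rewrite (on_ext _ (grid_base ij sg _)) // -ltnS.
rewrite -BD size_filter_num in le.
have [a0|] := posnP (\sum_(t < z.+1) a t)%N.
  have := small (grid_row iW jW ij zM sg (leq0n M')); move: VA Pbig Bbig.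
  by rewrite sizeE a0 E; clear; lia.
have [b0|] := posnP (\sum_(q < M'.+1) b q)%N; first by move: le Bsmall; rewrite b0; clear; lia.
move=> /sum_pos_term[q0 q0M bq0] /sum_pos_term[t0 t0z at0].
have [q1 [q2 [/andP[q12 q2M] bq1 bq2 bq]]] := @extremes (fun q => 0 < b q)%N M' q0 q0M bq0.
have [t1 [t2 [/andP[t12 t2z] at1 at2 at_]]] := @extremes (fun t => 0 < a t)%N z t0 t0z at0.
have bsum : (\sum_(q < M'.+1) b q = \sum_(q1 <= q < q2.+1) b q)%N.
  by apply: sum_range_supp; [rewrite ltnS q2M leqW | exact: bq].
(* Rows give up their two ends, since the corners are counted with the columns. *)
have asum : (\sum_(t < z.+1) a t <= \sum_(t1.+1 <= t < t2) a t + 2 * s.+1)%N.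
  rewrite (@sum_range_supp a t1 t2.+1 z.+1); [ | by rewrite ltnS t2z leqW | exact: at_].
  have aC t : (a t <= s.+1)%N by apply: leq_subr.
  have := aC t1; have := aC t2; move: t12; rewrite leq_eqVlt => /predU1P[->|t12].
    by rewrite big_nat1; clear; lia.
  rewrite (big_ltn (leqW t12)) big_nat_recr //=; clear; lia.
have col t : (t <= z)%N -> (0 < a t)%N -> (\sum_(q1 <= q < q2.+1) b q <=
    defect (k + s) H l l' (seg i j c' z t) M' + \sum_(q1 <= q < q2.+1) kP t q)%N.
  move=> tz apos.
  apply: leq_trans (leq_add (@sum_range_le (fun q => k + s - mult H (seg l l'
    (seg i j c' z t) M' q))%N q1 q2.+1 M'.+1 _) (leqnn _)); last by rewrite ltnS.
  rewrite -big_split /= !big_nat; apply: leq_sum => q qq.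
  have qM : (q <= M')%N by move: qq q2M; clear; lia.
  rewrite -(mult_ext _ (grid_swap sg t q)); have := multE t q tz qM.
  by move: apos; rewrite /a /b /g; clear; lia.
have row q : (q <= M')%N -> (0 < b q)%N -> (\sum_(t1.+1 <= t < t2) a t <=
    defect (k + s) H i j (seg l l' c' M' q) z + \sum_(t1.+1 <= t < t2) kP t q)%N.
  move=> qM bpos.
  apply: leq_trans (leq_add (@sum_range_le (fun t => k + s - mult H (seg i j
    (seg l l' c' M' q) z t))%N t1.+1 t2 z.+1 _) (leqnn _)); last by rewrite leqW.
  rewrite -big_split /= !big_nat; apply: leq_sum => t tt.
  have tz : (t <= z)%N by move: tt t2z; clear; lia.
  by have := multE t q tz qM; move: bpos; rewrite /a /b /g; clear; lia.
have per : (\sum_(q1 <= q < q2.+1) kP t1 q + \sum_(q1 <= q < q2.+1) kP t2 q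
    + \sum_(t1.+1 <= t < t2) kP t q1 + \sum_(t1.+1 <= t < t2) kP t q2 <= 2 * num H P)%N.
  rewrite /num big_distrr /= /kP.
  have ex m n (F : nat -> plane R T -> nat) : (\sum_(m <= t < n) \sum_(h <- H) F t h =
      \sum_(h <- H) \sum_(m <= t < n) F t h)%N by apply: exchange_big.
  rewrite !ex -!big_split; apply: sum_planes => h _ /=.
  case Ph: (P h); last by rewrite !big1.
  have /andP[hij hl] := Ph.
  have := @perimeter_hits R (val_at h (seg l l' c' M' 0)) (h.1 i - h.1 j) (h.1 l - h.1 l') t1 t2 q1 q2.
  rewrite !subr_eq0 => /(_ hij hl); rewrite muln1; apply: leq_trans.
  rewrite !leq_add //; rewrite !big_nat; apply: leq_sum => u uu /=; rewrite onG //;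
    by move: uu q12 q2M t12 t2z; clear; lia.
have C1 := col t1 (leq_trans t12 t2z) at1; have C2 := col t2 t2z at2.
have R1 := row q1 (leq_trans q12 q2M) bq1; have R2 := row q2 q2M bq2.
have sC1 := small (seg_in_layer iW jW ij zM (leq_trans t12 t2z) (grid_col sg (leq_trans t12 t2z))).
have sC2 := small (seg_in_layer iW jW ij zM t2z (grid_col sg t2z)).
have sR1 := small (grid_row iW jW ij zM sg (leq_trans q12 q2M)).
have sR2 := small (grid_row iW jW ij zM sg q2M).
rewrite bsum mulnS in le; rewrite sizeE E in sC1 sC2 sR1 sR2.
exact: (rectangle_arith _ Bbig le VA asum C1 C2 R1 R2 per sC1 sC2 sR1 sR2).
Qed.
End Layer.

Lemma pairD_crosses W i j l l' h : nonconst W h -> pairD W i l h ->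
  j \in W :\ i :\ l -> l' \in W :\ i :\ l -> l' != j -> l != j -> l != i -> l \in W ->
  (h.1 i != h.1 j) && nonconst (W :\ i :\ j) h.
Proof.
move=> ncW D jil l'il l'j lj li lW; rewrite eq_sym (pairD_ne ncW D jil) /=.
have := pairD_ne ncW D l'il; case/andP: D => /eqP-> _.
have [l'i _ l'W] := in_restP _ _ _ _ l'il.
by apply: contraR => /constP cst; rewrite (cst l' l) // !inE ?l'j ?lj ?l'i ?li ?l'W ?lW.
Qed.

(* Take the pair [i, j] for which the fewest planes are constant both on it and
   on its complement.  These planes contain whole layers [x i + x j = z]; each of
   them at most one, so that one of [d + 1] suitable layers is free of them. *)
Lemma defect_bound_step s w k K' : (s <= 2)%N -> (2 <= w)%N ->
  @defect_bound R T s w k K' -> @defect_bound R T s w.+2 (k + s) (K' + 9).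
Proof.
move=> s2 w2 IH W H c M cardW ncW.
apply: contrapT => /no_defect_bound small.
have /card_gt1P[u [v [uW vW uv]]] : (1 < #|W|)%N by rewrite cardW.
pose PP (p : T * T) := [&& p.1 \in W, p.2 \in W & p.1 != p.2].
have PPuv : PP (u, v) by rewrite /PP uW vW uv.
case: (arg_minnP (fun p => num H (pairD W p.1 p.2)) PPuv) => -[i j] /= /and3P[/= iW jW ij] pmin.
have {pmin}pair_min i' j' : i' \in W -> j' \in W -> i' != j' ->
    (num H (pairD W i j) <= num H (pairD W i' j'))%N.
  by move=> iW' jW' ij'; apply: (pmin (i', j')); rewrite /PP iW' jW' ij'.
have cardJ : #|W :\ i :\ j| = w.
  move: cardW; rewrite (cardsD1 i) iW (cardsD1 j (W :\ i)) !inE eq_sym ij jW.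
  by rewrite !add1n => -[].
have /card_gt1P[l [l' [lJ l'J ll']]] : (1 < #|W :\ i :\ j|)%N by rewrite cardJ.
have [li lj lW] := in_restP _ _ _ _ lJ; have [l'i l'j l'W] := in_restP _ _ _ _ l'J.
set d := num H (pairD W i j).
have ji : j != i by rewrite eq_sym.
have il : i != l by rewrite eq_sym.
(* The [pairD] planes of [i], [l] and those of [j], [l] are disjoint families of at least [d] planes
   each, all oblique for [i], [j]. *)
have Obig : (2 * d <= num H (pairO W i j))%N.
  apply: (leq_trans (n := num H (pairD W i l) + num H (pairD W j l))%N).
    by rewrite mul2n -addnn leq_add // pair_min // eq_sym.
  rewrite /num -big_split; apply: sum_planes => h hH /=.
  have cross a b : a \in W -> b \in W -> a != b -> l != a -> l != b -> l' != a -> l' != b ->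
      pairD W a l h -> (h.1 a != h.1 b) && nonconst (W :\ a :\ b) h.
    move=> aW bW ab la lb l'a l'b Dh.
    by apply: (pairD_crosses (ncW h hH) Dh (l' := l')) => //; rewrite !inE
      ?l'a ?l'W ?bW ?[_ == l]eq_sym ?ll' ?lb //= eq_sym ab.
  have JE : W :\ j :\ i = W :\ i :\ j.
    by apply/setP => x; rewrite !inE; case: (x == i); case: (x == j).
  have [Di|nDi] := boolP (pairD W i l h); have [Dj|nDj] //= := boolP (pairD W j l h).
  - have /andP[+ _] := cross i j iW jW ij li lj l'i l'j Di.
    by case/andP: Di => /eqP-> _; case/andP: Dj => /eqP-> _; rewrite eqxx.
  - by rewrite /pairO cross.
  - by rewrite /pairO eq_sym -JE cross.
pose c0 (x : T) := if x \in W then 0%N else c x.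
have seg0 a b : a \in W -> b \in W -> a != b -> seg_in W c M a b c0 M.
  move=> aW bW ab; split=> // t tM; apply: in_slice_seg => //.
    by move=> x xW; rewrite /c0 (negPf xW).
  rewrite big1 ?addn0 // => x; rewrite /c0 !inE => /and3P[_ _ ->] //.
have total := small _ _ _ _ (seg0 _ _ iW jW ij).
rewrite (size_pair W i j) in total.
set A := num H (pairA W i j) in total; set B := num H (pairB W i j) in total.
(* From [z = zlo] upward [free_layer_lower] applies, and from [z = M - zhi] downward
   [free_layer_upper]. *)
have floor n : exists q, (s.+1 * q <= n < s.+1 * q.+1)%N.
  by exists (n %/ s.+1)%N; rewrite ![(s.+1 * _)%N]mulnC leq_trunc_div ltn_ceil.
have [zlo /andP[loA Alo]] := floor A; have [zhi /andP[hiB Bhi]] := floor (B + K')%N.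
have dM : (zlo + zhi + d <= M)%N.
  rewrite -ltnS -(ltn_pmul2l (ltn0Sn s)) !mulnDr; apply: leq_ltn_trans total.
  have : (s.+1 * d <= 3 * d)%N by rewrite leq_mul2r orbC ltnS s2.
  by rewrite -/d; move: Obig loA hiB; clear; lia.
(* About a third of the candidates go up from [zlo], the rest down from [M - zhi]: the two lemmas
   gain [d] and [2 * d] respectively, and a layer costs [s.+1 <= 3]. *)
pose d1 := (d %/ 3).+1.
pose g t := if (t < d1)%N then (zlo + t)%N else (M - zhi - (t - d1))%N.
have gM t : (t < d.+1)%N -> (g t <= M)%N.
  by move: dM; rewrite /g /d1; case: (ltnP t (d %/ 3).+1); clear; lia.
have g_inj t t' : (t < d.+1)%N -> (t' < d.+1)%N -> g t = g t' -> t = t'.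
  by move: dM; rewrite /g /d1; case: (ltnP t (d %/ 3).+1); case: (ltnP t' (d %/ 3).+1); clear; lia.
(* There are [d] planes of type [pairD], each in at most one of the [d.+1] candidate layers. *)
have [|t] := @exists_le_of_sum _ (fun t : 'I_d.+1 =>
    \sum_(h <- H) (pairD W i j h && on h (seg i l c0 M (g t))))%N (fun=> 1%N).
  rewrite sum_nat_const card_ord muln1 ltnS exchange_big /=.
  apply: sum_planes => h hH; case Dh: (pairD W i j h) => /=; last by rewrite big1.
  apply: (sum_pred_le1 (P := fun t => on h (seg i l c0 M (g t)))) => a b ad bd oa ob.
  apply: g_inj => //; apply: (seg_inj _ _ (gM _ ad) (gM _ bd) oa ob).
    by rewrite eq_sym.
  by rewrite eq_sym (pairD_ne (ncW h hH) Dh).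
rewrite ltnS leqn0 sum_nat_seq_eq0 => /allP none.
have td := ltn_ord t; have zM := gM t td; set z := g t in zM none.
have free : {in H, forall h, pairD W i j h -> forall x, in_slice W c M x ->
    (x i + x j = z)%N -> ~~ on h x}.
  move=> h hH Dh x xW xz; have [_ _ _ /(_ z zM) S] := seg0 _ _ iW lW il.
  have := none h hH; rewrite Dh /= eqb0; apply: contra.
  case/andP: Dh => /eqP hij nJ; rewrite (layer_const iW jW ij hij nJ xW S) //.
  by rewrite xz /seg eqxx (negPf ji) [j == l]eq_sym (negPf lj) /c0 jW addn0.
have w0 : (0 < w)%N by apply: leq_trans w2.
have low := @free_layer_lower s w k K' IH W H c M i j iW jW ij cardJ w0 small z zM free.
have upp := @free_layer_upper s w k K' IH W H c M i j iW jW ij cardJ small z zM free s2 ncW pair_min.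
rewrite -/A -/B -/d in low upp.
have C3 n : (s.+1 * n <= 3 * n)%N by rewrite leq_mul2r orbC ltnS s2.
move: low upp; rewrite /z /g; case: (ltnP t d1) => td1 low upp.
  have : (A < s.+1 * (zlo + t).+1)%N.
    by apply: leq_trans Alo _; rewrite leq_mul2l ltnS leq_addr orbT.
  by move/low; rewrite mulnDr; have := C3 t; move: td1 loA; rewrite /d1; clear; lia.
have zE : (M - (M - zhi - (t - d1)) = zhi + (t - d1))%N by move: td td1 dM; rewrite /d1; clear; lia.
rewrite zE in upp; have : (B + K' < s.+1 * (zhi + (t - d1)).+1)%N.
  by apply: leq_trans Bhi _; rewrite leq_mul2l ltnS leq_addr orbT.
by move/upp; rewrite mulnDr; have := C3 (t - d1)%N; move: td td1 hiB; rewrite /d1; clear; lia.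
Qed.
End Step.

(** * Lower bounds for covers *)

Section Cover.
Variables (R : realFieldType) (T : finType).
Implicit Types (h : plane R T) (W : {set T}) (x : T -> nat).

Definition covers W c M (H : seq (plane R T)) k :=
  {in H, forall h, nonconst W h} /\ forall x, in_slice W c M x -> (k <= mult H x)%N.

Definition cover_bound w k p q K := forall W c M (H : seq (plane R T)),
  #|W| = w -> covers W c M H k -> (p * M.+1 <= q * size H + K)%N.

Lemma defect_bound_cover s w k K : @defect_bound R T s w k K -> cover_bound w k s.+1 1 K.
Proof.
move=> DB W c M H cardW [ncW cov]; rewrite mul1n.
have [u [v [c' [M' [[_ _ _ sg] le]]]]] := DB W H c M cardW ncW.
have d0 : defect k H u v c' M' = 0%N.
  by apply: big1 => t _; apply/eqP/cov/sg; rewrite -ltnS.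
by move: le; rewrite d0 addn0.
Qed.

Lemma defect_bound_double m : exists K, @defect_bound R T 1 (2 * m).+2 m.+2 K.
Proof.
elim: m => [|m [K IH]]; first by exists 0%N; apply: defect_bound_pair.
exists (K + 9)%N; have := @defect_bound_step R T 1 (2 * m).+2 m.+2 K isT isT IH.
by rewrite addn1 mulnS.
Qed.

(** The step adds two vertices, so both parities are carried along, starting from the segment and
    the triangle. *)
Lemma defect_bound_succ m : exists K, @defect_bound R T 2 m.+2 m.+3 K.
Proof.
suff: (exists K, @defect_bound R T 2 m.+2 m.+3 K) /\
      (exists K, @defect_bound R T 2 m.+3 m.+4 K) by case.
elim: m => [|m [[K IH] ex]].
  split; first by exists 0%N; apply: defect_bound_pair.
  by exists 3%N; apply: defect_bound_triangle.
split=> //; exists (K + 9)%N; have := @defect_bound_step R T 2 m.+2 m.+3 K isT isT IH.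
by rewrite addn2.
Qed.

(** * Removing one vertex from a cover *)

Section Cone.
Variables (W : {set T}) (c : T -> nat) (M : nat) (H : seq (plane R T)) (k : nat).
Variables (W3 : (3 <= #|W|)%N) (cov : covers W c M H k).

Definition facet i h := ~~ nonconst (W :\ i) h.

(** With at least three vertices two facets share one, so a plane with constant coefficients on both
    would be constant on [W]. *)
Lemma facet_sum : (\sum_(i in W) num H (facet i) <= size H)%N.
Proof.
rewrite exchange_big size_num; apply: sum_planes => h hH /=; rewrite big_mkcond /=.
rewrite (eq_bigr (fun i => ((i \in W) && facet i h : nat))); last first.
  by move=> i _; case: (i \in W).
apply: sum_bool_le1 => i j /andP[iW /constP ci] /andP[jW /constP cj].
apply: contraTeq ((proj1 cov) h hH) => ij.
have /card_gt0P[l] : (0 < #|W :\ i :\ j|)%N.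
  move: W3; rewrite (cardsD1 i) iW (cardsD1 j (W :\ i)) !inE eq_sym ij jW /=.
  by rewrite !add1n !ltnS.
rewrite !inE => /and3P[lj li lW].
have all u : u \in W -> h.1 u = h.1 l.
  move=> uW; have [->|ui] := eqVneq u i; last by apply: ci; rewrite !inE ?ui ?li.
  by apply: cj; rewrite !inE ?ij ?lj.
by apply/constP => u v uW vW; rewrite !all.
Qed.

Lemma sum_below e N : (e <= N)%N -> (\sum_(z < N) (z < e)%N)%N = e.
Proof.
move=> eN; rewrite (eq_bigr (fun z : 'I_N => if (z < e)%N then 1 else 0)%N); last first.
  by move=> z _; case: (_ < _)%N.
by rewrite -big_mkcond (big_ord_narrow eN) sum1_card card_ord.
Qed.

(** For a vertex [i] with the fewest facet planes, [S] is their number and [a], [b] are the first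
    layers with none and with at most one of them. Layers before [a] hold at least one and those
    before [b] at least two, whence [a + b <= S]. *)
Lemma cone : exists S a b, [/\ (a + b <= S)%N, (S <= size H)%N, (#|W| * S <= size H)%N,
   (forall p q K, cover_bound #|W|.-1 k p q K ->
      (p * (M.+1 - a) <= q * (size H - S) + K)%N) &
   (forall p q K, cover_bound #|W|.-1 k.-1 p q K ->
      (p * (M.+1 - b) <= q * (size H - S) + K)%N)].
Proof.
have /card_gt0P[i0 i0W] : (0 < #|W|)%N by apply: leq_trans W3.
case: (arg_minnP (fun i => num H (facet i)) i0W) => i iW imin.
have {}iW : i \in W by [].
set S := num H (facet i) in imin.
have wS : (#|W| * S <= size H)%N.
  by apply: leq_trans facet_sum; rewrite -sum_nat_const; apply: leq_sum.
have SH : (S <= size H)%N by apply: leq_trans wS; rewrite leq_pmull // (leq_trans _ W3).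
have cardW' : #|W :\ i| = #|W|.-1 by rewrite [in RHS](cardsD1 i) iW.
have /card_gt0P[l] : (0 < #|W :\ i|)%N by rewrite cardW' -ltnS prednK ?(leq_trans _ W3).
rewrite !inE => /andP[li lW].
pose c0 (x : T) := if x \in W then 0%N else c x.
have pin z : (z <= M)%N -> in_slice (W :\ i) (upd c i z) (M - z) (seg i l c0 M z).
  move=> zM; split=> [v|].
    rewrite !inE negb_and negbK /upd /seg; have [//|vi] := eqVneq v i.
    by move=> /= vW; rewrite ifN /c0 ?(negPf vW) //; apply: contraNneq vW => ->.
  rewrite (big_setD1 l) ?inE ?li //= big1 ?addn0.
    by rewrite /seg (negPf li) eqxx.
  by move=> v; rewrite !inE /seg /c0 => /and3P[/negPf-> /negPf-> ->].
have sub z x : (z <= M)%N -> in_slice (W :\ i) (upd c i z) (M - z) x -> in_slice W c M x.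
  move=> zM [xc xM]; split=> [v vW|].
    by rewrite xc ?inE ?(negPf vW) ?andbF // /upd ifN //; apply: contraNneq vW => ->.
  by rewrite (big_setD1 i) //= xM xc ?inE ?eqxx // /upd eqxx subnKC.
pose m z := (\sum_(h <- H) (facet i h && on h (seg i l c0 M z)))%N.
have mS : (\sum_(z < M.+1) m z <= S)%N.
  apply: mult_seg_le; rewrite 1?eq_sym // => h hH /constP ci.
  apply: contraTneq ((proj1 cov) h hH) => hil.
  have all u : u \in W -> h.1 u = h.1 l.
    by move=> uW; have [->//|ui] := eqVneq u i; apply: ci; rewrite !inE ?ui ?li.
  by apply/constP => u v uW vW; rewrite !all.
have slice z r p q K : ((z < M.+1)%N -> (m z <= r)%N) ->
    cover_bound #|W|.-1 (k - r) p q K -> (p * (M.+1 - z) <= q * (size H - S) + K)%N.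
  (* A search that reached its cap [M.+1] yields an empty layer, and the bound is trivial. *)
  move=> mz CB; have [zM|Mz] := leqP z M; last first.
    by rewrite (_ : M.+1 - z = 0)%N ?muln0 //; apply/eqP; rewrite subn_eq0.
  have := CB (W :\ i) (upd c i z) (M - z)%N (filter (nonconst (W :\ i)) H) cardW'.
  have -> : size (filter (nonconst (W :\ i)) H) = (size H - S)%N.
    rewrite size_filter_num size_num (_ : num H xpredT = num H (nonconst (W :\ i)) + S)%N ?addnK //.
    by rewrite /S /num -big_split; apply: eq_bigr => h _; rewrite /facet; case: nonconst.
  rewrite -subSn //; apply; split=> [h|x xin]; first by rewrite mem_filter => /andP[].
  rewrite leq_subLR; apply: leq_trans ((proj2 cov) x (sub z x zM xin)) _.
  apply: leq_trans (leq_add (mz _) (leqnn _)) => //.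
  rewrite mult_filter -big_split; apply: sum_planes => h hH /=.
  have [nc|nc] := boolP (nonconst (W :\ i) h); first by rewrite leq_addl.
  by rewrite addn0 /facet nc (on_const nc xin (pin z zM)).
have [a [aM ma La]] := least_below m 0 M.+1.
have [b [bM mb Lb]] := least_below m 1 M.+1.
exists S, a, b; split=> //.
- apply: leq_trans mS; rewrite -(sum_below aM) -(sum_below bM) -big_split.
  apply: leq_sum => z _ /=; have := La z; have := Lb z.
  by case: (ltnP z b) => _; case: (ltnP z a) => _; clear; lia.
- by move=> p q K CB; apply: (@slice a 0%N) => //; rewrite subn0.
- by move=> p q K CB; apply: (@slice b 1%N) => //; rewrite subn1.
Qed.
End Cone.
End Cover.

(** Follows from [n <= (n - a) + S] and [(k + e).+1 * S <= N - S]; here [k] is one less than the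
    covering multiplicity. *)
Lemma cone_arith_high k e n a N S K : (a <= S)%N -> (S <= N)%N -> ((k + e).+2 * S <= N)%N ->
  ((k + e).+1 * (n - a) <= e.+1 * (N - S) + K)%N -> ((k + e).+2 * n <= e.+2 * N + 2 * K)%N.
Proof.
move=> aS /subnK<-; rewrite addnK; move: (N - S)%N => Y wS le.
have h1 := leq_mul (leqnn (k + e).+2) le.
have h2 : (k * ((k + e).+1 * S) <= k * Y)%N.
  by rewrite leq_mul2l; apply/orP; right; move: wS; clear; lia.
have h3 := leq_mul (leqnn ((k + e).+1 * (k + e).+2)) (_ : n <= (n - a) + S)%N.
have {}h3 := h3 (ltac:(move: aS; clear; lia)).
rewrite -(leq_pmul2l (ltn0Sn (k + e))).
move: (n - a)%N h1 h2 h3 => X; clear; lia.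
Qed.

(** The two layer bounds are added, using [2 * n <= (n - a) + (n - b) + S]. *)
Lemma cone_arith_low r t n a b N S K1 K2 :
  (a + b <= S)%N -> (S <= N)%N -> ((2 * r + t).+3 * S <= N)%N ->
  (3 * (2 * r + t).+2 * (n - a) <= (3 * r + t).+2 * (N - S) + K1)%N ->
  (3 * (2 * r + t).+2 * (n - b) <= (3 * r + t).+3 * (N - S) + K2)%N ->
  (3 * (2 * r + t).+3 * n <= (3 * r + t).+4 * N + (K1 + K2))%N.
Proof.
move=> abS /subnK<-; rewrite addnK; move: (N - S)%N => Y wS le1 le2.
have h1 := leq_mul (leqnn (2 * r + t).+3) (leq_add le1 le2).
have h2 : (t.+1 * ((2 * r + t).+2 * S) <= t.+1 * Y)%N.
  by rewrite leq_mul2l /=; move: wS; clear; lia.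
have n2 : (2 * n <= (n - a) + (n - b) + S)%N by move: abS; clear; lia.
have h3 := leq_mul (leqnn (3 * (2 * r + t).+2 * (2 * r + t).+3)) n2.
have u0 : (0 < 2 * (2 * r + t).+2)%N by [].
rewrite -(leq_pmul2l u0).
move: (n - a)%N (n - b)%N h1 h2 h3 => X1 X2; clear; lia.
Qed.

Section Bounds.
Variables (R : realFieldType) (T : finType).

(** [j] counts the vertices beyond the end [w = 2k - 2]; the ratio is [w / (w - k + 1)]. *)
Lemma cover_bound_high m j : exists K,
  @cover_bound R T (2 * m + j).+2 m.+2 (2 * m + j).+2 (m + j).+1 K.
Proof.
elim: j => [|j [K IH]].
  have [K DB] := defect_bound_double R T m; exists (m.+1 * K)%N => W c M H cardW cov.
  rewrite addn0 in cardW; have := defect_bound_cover DB cardW cov.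
  move/(leq_mul (leqnn m.+1)); rewrite !addn0; clear; lia.
exists (2 * K)%N => W c M H cardW cov.
have W3 : (3 <= #|W|)%N by rewrite cardW addnS.
have [S [a [b [abS SH wS bound _]]]] := cone W3 cov.
rewrite cardW addnS /= in bound wS; have {}bound := bound _ _ _ IH.
have E : (2 * m + j = m + (m + j))%N by rewrite mul2n -addnn addnA.
rewrite !addnS; rewrite E -addSn in bound wS *.
apply: cone_arith_high bound => //; exact: leq_trans (leq_addr b a) abS.
Qed.

(** [r = 0] is the end [w = k - 1] and [t = 0] the end [w = 2k - 2]. Removing a vertex leads from
    [(r, t)] to [(r - 1, t + 1)] for [k] and to [(r, t - 1)] for [k - 1]. *)
Lemma cover_bound_low r t : (2 <= 2 * r + t)%N -> exists K,
  @cover_bound R T (2 * r + t) (r + t).+1 (3 * (2 * r + t)) (3 * r + t) K.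
Proof.
move E: (2 * r + t)%N => w; elim: w r t E => // w IH r t E w2.
case: r t E => [|r] [|t] E.
- by [].
- case: t E => [E|t E]; first by move: E w2; clear; lia.
  have [K DB] := defect_bound_succ R T t; exists (w.+1 * K)%N => W c M H cardW cov.
  have tw : t.+1 = w by case: E.
  rewrite -tw in cardW *; have := defect_bound_cover DB cardW cov.
  move/(leq_mul (leqnn t.+2)); clear; lia.
- have [K DB] := defect_bound_double R T r; exists (3 * r.+1 * K)%N => W c M H cardW cov.
  rewrite addn0 in E; rewrite -E mulnS in cardW.
  rewrite addn0 in cov; have := defect_bound_cover DB cardW cov.
  rewrite -E; move/(leq_mul (leqnn (3 * r.+1))); clear; lia.
have Ew : w = (2 * r + t).+2 by move: E; clear; lia.
have w2' : (2 <= w)%N by rewrite Ew.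
have E1 : (2 * r + t.+2 = w)%N by move: E; clear; lia.
have E2 : (2 * r.+1 + t = w)%N by move: E; clear; lia.
have [K1 IH1] := IH _ _ E1 w2'; have [K2 IH2] := IH _ _ E2 w2'.
exists (K1 + K2)%N => W c M H cardW cov.
have W3 : (3 <= #|W|)%N by rewrite cardW Ew.
have [S [a [b [abS SH wS b1 b2]]]] := cone W3 cov.
rewrite cardW /= in b1 b2 wS.
have {}b1 : (3 * w * (M.+1 - a) <= (3 * r + t.+2) * (size H - S) + K1)%N.
  by apply: b1; have -> : (r.+1 + t.+1).+1 = (r + t.+2).+1 by clear; lia.
have {}b2 : (3 * w * (M.+1 - b) <= (3 * r.+1 + t) * (size H - S) + K2)%N.
  by apply: b2; have -> : (r.+1 + t.+1)%N = (r.+1 + t).+1 by clear; lia.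
rewrite Ew in b1 b2 wS *.
have e1 : (3 * r + t.+2 = (3 * r + t).+2)%N by clear; lia.
have e2 : (3 * r.+1 + t = (3 * r + t).+3)%N by clear; lia.
have e3 : (3 * r.+1 + t.+1 = (3 * r + t).+4)%N by clear; lia.
rewrite e1 in b1; rewrite e2 in b2; rewrite e3.
exact: cone_arith_low abS SH wS b1 b2.
Qed.
End Bounds.

(** * Hyperplanes and the function [f] *)

Section Transfer.
Variables (R : realType) (d k : nat).
Implicit Types (H : seq (hyperplane R d)) (x : 'I_d -> nat).

(** Vertex [ord0] carries the slack coordinate, with coefficient 0; hence a nonzero normal vector is
    never constant on all vertices. *)
Definition plane_of (h : hyperplane R d) : plane R 'I_d.+1 :=
  (fun v => if unlift ord0 v is Some i then h.1 ord0 i else 0, h.2).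

Lemma on_plane_of h (y : 'I_d.+1 -> nat) :
  on (plane_of h) y = on_hyp h (fun i => y (lift ord0 i)).
Proof.
rewrite /on /val_at /on_hyp subr_eq0 big_ord_recl /= unlift_none mul0r add0r.
by congr (_ == _); apply: eq_bigr => i _; rewrite liftK.
Qed.

Lemma nonconst_plane_of h : is_hyperplane h -> nonconst setT (plane_of h).
Proof.
apply: contraR => /constP cst; apply/eqP/rowP => i; rewrite mxE.
have := cst (lift ord0 i) ord0 (in_setT _) (in_setT _).
by rewrite /= liftK unlift_none.
Qed.

Lemma kcover_lower p q K n H : @cover_bound R 'I_d.+1 d.+1 k p q K ->
  is_kcover n.+1 k H -> (p * n.+1 <= q * size H + K)%N.
Proof.
move=> CB [/allP hyp cov]; rewrite -(size_map plane_of).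
apply: (CB setT (fun=> 0%N) n); first by rewrite cardsT card_ord.
split=> [_ /mapP[h hH ->]|y [_ yn]]; first by apply: nonconst_plane_of; apply: hyp.
rewrite /mult big_map; apply: leq_trans (cov (fun i => y (lift ord0 i)) _) _.
  by rewrite /inT ltnS -yn (eq_bigl xpredT) ?big_ord_recl ?leq_addl // => v; rewrite inE.
by rewrite -sum1_count big_mkcond; apply: leq_sum => h _; rewrite on_plane_of; case: on_hyp.
Qed.

(** A known cover excludes the default value 0 of [f]. *)
Lemma fP n m : has_kcover_of_size R n d k m ->
  has_kcover_of_size R n d k (f R n d k) /\ (f R n d k <= m)%N.
Proof.
move=> Hm; rewrite /f; case: pselect => [Hex|]; last by case; exists m.
case: ex_minnP => r /asboolP Hr rmin; split=> //.
by apply: rmin; apply/asboolP.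
Qed.

Definition bary n x (v : 'I_d.+1) : nat :=
  if unlift ord0 v is Some i then x i else (n - \sum_i x i)%N.

Definition bary_plane n (v : 'I_d.+1) (c : nat) : hyperplane R d :=
  if unlift ord0 v is Some i then (delta_mx ord0 i, c%:R)
  else (const_mx 1, n%:R - c%:R).

Lemma on_bary_plane n x v c : inT n.+1 x ->
  on_hyp (bary_plane n v c) x = (c == bary n x v).
Proof.
rewrite /inT ltnS /on_hyp /bary_plane /bary => xn; case: unliftP => [i _|_] /=.
  rewrite (bigD1 i) //= big1 ?addr0 => [|j /negPf ji].
    by rewrite mxE !eqxx mul1r eqr_nat eq_sym.
  by rewrite mxE ji andbF mul0r.
under eq_bigr do rewrite mxE mul1r.
have nE : n%:R = (n - \sum_i x i)%:R + (\sum_i x i)%:R :> R by rewrite -natrD subnK.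
by rewrite -natr_sum nE eq_sym addrAC -subr_eq0 addrK subr_eq0 eqr_nat eq_sym.
Qed.

(* [L] lists the levels, with multiplicity, at which each barycentric coordinate
   is fixed. *)
Lemma kcover_upper n s q t (L : seq nat) : (0 < d)%N ->
  (q + k = s * d.+1 + 1)%N -> (n < q * t)%N ->
  (forall y, (s * t <= y + count_mem y L * t)%N) ->
  has_kcover_of_size R n.+1 d k (d.+1 * size L).
Proof.
move=> d0 qk nqt HL.
exists (flatten [seq [seq bary_plane n v c | c <- L] | v <- enum 'I_d.+1]); split.
  rewrite size_flatten /shape -map_comp sumnE big_map.
  rewrite (eq_bigr (fun=> size L)) => [|v _]; last by rewrite /= size_map.
  by rewrite big_enum sum_nat_const card_ord.
split.
  apply/allP => _ /flattenP[_ /mapP[v _ ->] /mapP[c _ ->]].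
  rewrite /is_hyperplane /bary_plane; case: unliftP => [i _|_] /=.
    by apply/eqP => /matrixP/(_ ord0 i)/eqP; rewrite !mxE !eqxx oner_eq0.
  by apply/eqP => /matrixP/(_ ord0 (Ordinal d0))/eqP; rewrite !mxE oner_eq0.
move=> x xn; rewrite count_flatten -map_comp sumnE big_map big_enum /=.
rewrite (eq_big xpredT (fun v => count_mem (bary n x v) L)) => // [|v _]; last first.
  by rewrite count_map; apply: eq_count => c /=; rewrite on_bary_plane.
have bn : (\sum_v bary n x v = n)%N.
  rewrite big_ord_recl [X in (_ + X)%N](eq_bigr x) => [|i _]; last by rewrite /bary liftK.
  by rewrite /bary unlift_none subnK.
have : (\sum_(v < d.+1) s * t <=
    \sum_(v < d.+1) (bary n x v + count_mem (bary n x v) L * t))%N.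
  by apply: leq_sum => v _; apply: HL.
rewrite big_split /= bn sum_nat_const card_ord -big_distrl /=.
(* With [m < k] planes through the point, [q + m <= s * d.+1], so [(q + m) * t <= n + m * t],
   against [n < q * t]. *)
move: (\sum_v _)%N => m le; rewrite leqNgt; apply/negP => mk.
have : (q * t + m * t <= s * d.+1 * t)%N.
  by rewrite -mulnDl leq_mul2r; apply/orP; right; move: qk mk; clear; lia.
by move: le nqt; clear; lia.
Qed.
End Transfer.

(** * Asymptotics of the covering number *)

Lemma asymptotics (R : realType) (F : nat -> nat) (C : R) p q K1 K2 : (0 < q)%N ->
  C = p%:R / q%:R ->
  (forall n, (p * n.+1 <= q * F n.+1 + K1)%N) ->
  (forall n, (q * F n.+1 <= p * n.+1 + K2)%N) ->
  exists K : R, forall n, (1 <= n)%N -> `|(F n)%:R - C * n%:R| <= K.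
Proof.
move=> q0 -> lo up; exists (K1 + K2)%:R => -[//|n] _.
have q1 : 1 <= q%:R :> R by rewrite ler1n.
have qp : 0 < q%:R :> R by rewrite ltr0n.
have E : (F n.+1)%:R - p%:R / q%:R * n.+1%:R =
    (q%:R * (F n.+1)%:R - p%:R * n.+1%:R) / q%:R :> R.
  by field; rewrite gt_eqF.
have {}lo : p%:R * n.+1%:R <= q%:R * (F n.+1)%:R + K1%:R :> R.
  by rewrite -!natrM -natrD ler_nat lo.
have {}up : q%:R * (F n.+1)%:R <= p%:R * n.+1%:R + K2%:R :> R.
  by rewrite -!natrM -natrD ler_nat up.
have K10 := ler0n R K1; have K20 := ler0n R K2.
rewrite E normrM normfV (gtr0_norm qp) ler_pdivrMr // natrD ler_norml.
have : K1%:R + K2%:R <= (K1%:R + K2%:R) * q%:R :> R by rewrite ler_peMr // addr_ge0.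
by move=> le; apply/andP; split; lra.
Qed.

Lemma count_mem_iota0 y m : count_mem y (iota 0 m) = (y < m)%N :> nat.
Proof. by rewrite count_uniq_mem ?iota_uniq // mem_iota. Qed.

(** The cover uses [t = n %/ q + 1], the least [t] with [n < q * t]; rounding costs at most
    [p * q]. *)
Lemma f_asymptotics (R : realType) d k p q s e K1 (L : nat -> seq nat) (C : R) :
  (0 < d)%N -> (0 < q)%N -> (q + k = s * d.+1 + 1)%N -> p = (d.+1 * e)%N ->
  C = p%:R / q%:R -> @cover_bound R 'I_d.+1 d.+1 k p q K1 ->
  (forall t, size (L t) = e * t)%N ->
  (forall t y, s * t <= y + count_mem y (L t) * t)%N ->
  exists K : R, forall n, (1 <= n)%N -> `|(f R n d k)%:R - C * n%:R| <= K.
Proof.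
move=> d0 q0 qk pE CE CB sizeL HL.
have cover n : has_kcover_of_size R n.+1 d k (d.+1 * size (L (n %/ q).+1)).
  by apply: (@kcover_upper R d k n s q (n %/ q).+1 _ d0 qk) => //; rewrite mulnC ltn_ceil.
apply: (@asymptotics R (fun n => f R n d k) C p q K1 (p * q)) => // n.
  by have [[H [<- cov]] _] := fP (cover n); apply: kcover_lower CB cov.
have [_ le] := fP (cover n); move/(leq_mul (leqnn q)): le => /leq_trans; apply.
rewrite sizeL (_ : q * _ = p * (q * (n %/ q).+1))%N; last by rewrite pE; ring.
rewrite -mulnDr leq_mul2l; apply/orP; right.
by rewrite addnC mulnS leq_add2l leqW // mulnC leq_trunc_div.
Qed.

Unset Implicit Arguments.

Theorem mainTheorem11 (R : realType) :
  (forall k d : nat, (2 <= k)%N -> (2 * k - 3 <= d)%N ->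
     exists K : R, forall n : nat, (1 <= n)%N ->
       `| (f R n d k)%:R
          - (1 + (k%:R - 1) / (d%:R - k%:R + 2)) * n%:R | <= K)
  /\
  (forall k d : nat, (3 <= k)%N -> (k - 2 <= d)%N -> (d <= 2 * k - 3)%N ->
     exists K : R, forall n : nat, (1 <= n)%N ->
       `| (f R n d k)%:R
          - (2 + (2 * k%:R - 3 - d%:R) / (2 * d%:R + 3 - k%:R)) * n%:R | <= K).
Proof.
split=> [k d k2 dk|k d k3 kd dk].
  pose m := (k - 2)%N; pose j := (d - (2 * k - 3))%N.
  have kE : k = m.+2 by rewrite /m; lia.
  have dE : d = (2 * m + j).+1 by rewrite /j; lia.
  have [K1 CB] := cover_bound_high R 'I_d.+1 m j.
  (* Each level below [t] is used once, and [(m + j).+1] is [d - k + 2]. *)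
  apply: (@f_asymptotics R d k d.+1 (m + j).+1 1 1 K1 (fun t => iota 0 t)) => //.
  - by rewrite dE.
  - by rewrite kE dE; lia.
  - by rewrite muln1.
  - have dR : d%:R = 2 * m%:R + j%:R + 1 :> R by rewrite -natrM -natrD natr1 -dE.
    have kR : k%:R = m%:R + 2 :> R by rewrite -natrD addn2 -kE.
    rewrite -[d.+1%:R]natr1 dR kR -[(m + j).+1%:R]natr1 natrD; field.
    by rewrite -natrD natr1 pnatr_eq0.
  - by rewrite kE dE in CB *.
  - by move=> t; rewrite size_iota mul1n.
  - by move=> t y; rewrite count_mem_iota0; case: ltnP => /=; lia.
pose r := (d - (k - 2))%N; pose t := (2 * k - 3 - d)%N.
have kE : k = (r + t).+1 by rewrite /r /t; lia.
have dE : d.+1 = (2 * r + t)%N by rewrite /r /t; lia.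
have [|K1 CB] := cover_bound_low R 'I_d.+1 (r := r) (t := t); first by lia.
(* Levels below [t] are used twice and those from [t] to [2 * t - 1] once; [3 * r + t] is
   [2 * d + 3 - k]. *)
apply: (@f_asymptotics R d k (3 * d.+1) (3 * r + t) 2 3 K1
  (fun t => iota 0 t ++ iota 0 (2 * t))) => //.
- by lia.
- by lia.
- by lia.
- by rewrite mulnC.
- have dR : d%:R = 2 * r%:R + t%:R - 1 :> R by rewrite -natrM -natrD -dE -natr1 addrK.
  have kR : k%:R = r%:R + t%:R + 1 :> R by rewrite kE -natr1 natrD.
  rewrite natrM -[d.+1%:R]natr1 dR kR natrD natrM; field.
  by rewrite -!natrM -natrD pnatr_eq0; lia.
- by rewrite kE; rewrite -dE in CB.
- by move=> t'; rewrite size_cat !size_iota; lia.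
- move=> t' y; rewrite count_cat !count_mem_iota0.
  by case: (ltnP y t'); case: (ltnP y (2 * t')) => /=; lia.
Qed.
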